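(* For any initial value $u_0\in C(\Gamma(0))$ there exists at most one viscosity solution to $$\partial^\bullet u(x,t)+H(x,t,\nabla_\Gamma u(x,t))=0\ \text{ for }(x,t)\in S_T,\qquad u(x,0)=u_0(x)\ \text{ for }x\in\Gamma(0).$$
   Context: Evolving surface. $\Gamma_0\subset\mathbb{R}^3$ is a closed (compact, without boundary), connected, oriented, smooth hypersurface, $T>0$, and $\Phi:\Gamma_0\times[0,T]\to\mathbb{R}^3$ is a smooth flow map such that $\Phi(\cdot,t)$ is a diffeomorphism of $\Gamma_0$ onto a hypersurface $\Gamma(t)$, with $\Phi(X,0)=X$ and $\partial_t\Phi(X,t)=v_\Gamma(\Phi(X,t),t)$; the velocity field satisfies $v_\Gamma\in C^1(\overline{S_T})$. Here $S_T=\bigcup_{t\in(0,T)}\Gamma(t)\times\{t\}$ and $\overline{S_T}=\bigcup_{t\in[0,T]}\Gamma(t)\times\{t\}\subset\mathbb{R}^4$. $\nu(\cdot,t)$ is the unit outward normal of $\Gamma(t)$ and $P_\Gamma=I_3-\nu\otimes\nu$. For differentiable $f$, $\nabla_\Gamma f=P_\Gamma\nabla\tilde f$ is the tangential gradient ($\tilde f$ any smooth extension of $f$ to a neighbourhood), and $\partial^\bullet f$ is the material derivative, $\partial^\bullet f(\Phi(X,t),t)=\frac{d}{dt}\bigl(f(\Phi(X,t),t)\bigr)$, equivalently $\partial^\bullet f=\partial_t\tilde f+v_\Gamma\cdot\nabla\tilde f$. Hamiltonian. $H:\overline{S_T}\times\mathbb{R}^3\to\mathbb{R}$ satisfies, with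 positive constants $L_{H,1},L_{H,2}$, for all $(x,t),(y,s)\in\overline{S_T}$, $p,q\in\mathbb{R}^3$: $|H(x,t,p)-H(y,s,p)|\le L_{H,1}(|x-y|+|t-s|)(1+|p|)$ and $|H(x,t,p)-H(x,t,q)|\le L_{H,2}|p-q|$. Viscosity solutions. $USC(\overline{S_T})$, $LSC(\overline{S_T})$ denote the upper, lower semicontinuous functions on $\overline{S_T}$. A locally bounded $u\in USC(\overline{S_T})$ (resp. $u\in LSC(\overline{S_T})$) is a viscosity subsolution (resp. supersolution) if $u(x,0)\le u_0(x)$ (resp. $u(x,0)\ge u_0(x)$) for all $x\in\Gamma(0)$ and, for any $\varphi\in C^1(\overline{S_T})$, whenever $u-\varphi$ takes a local maximum (resp. minimum) at $(x_0,t_0)\in\overline{S_T}$ with $t_0>0$ (so $t_0=T$ is allowed), then $\partial^\bullet\varphi(x_0,t_0)+H(x_0,t_0,\nabla_\Gamma\varphi(x_0,t_0))\le0$ (resp. $\ge0$). A viscosity solution is a function that is both a viscosity subsolution and a viscosity supersolution. *)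

(* Defs.v *)
From HB Require Import structures.
From mathcomp Require Import all_boot all_order all_algebra.
From mathcomp Require Import all_classical all_reals all_analysis.

Set Implicit Arguments.
Unset Strict Implicit.
Unset Printing Implicit Defensive.

Import Order.TTheory GRing.Theory Num.Theory.
Import numFieldNormedType.Exports.

Local Open Scope classical_set_scope.
Local Open Scope ring_scope.

(* V is meant to be finite-dimensional: there, continuity of every directional
   derivative is C^1, and differentiability of all iterated ones is C^oo. *)
Section Regularity.
Context {R : realType} {V W : normedModType R}.

Definition C1_on (U : set V) (f : V -> W) :=
  forall x, U x ->
    differentiable f x /\ forall v, {for x, continuous (fun y => 'D_v f y)}.

Fixpoint iter_derive (vs : seq V) (f : V -> W) : V -> W :=
  if vs is v :: vs' then iter_derive vs' (fun y => 'D_v f y) else f.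

Definition smooth_on (U : set V) (f : V -> W) :=
  forall vs x, U x -> differentiable (iter_derive vs f) x.

Definition local_extension (reg : set V -> (V -> W) -> Prop)
    (A : set V) (f : V -> W) (x : V) (ft : V -> W) :=
  exists U : set V,
    [/\ open U, U x, reg U ft & forall y, A y -> U y -> ft y = f y].

(* For a subset A that need not be open, regularity means that f extends, near
   every point of A, to a regular map on an open set of the ambient space. *)
Definition C1_set (A : set V) (f : V -> W) :=
  forall x, A x -> exists ft, local_extension C1_on A f x ft.

Definition smooth_set (A : set V) (f : V -> W) :=
  forall x, A x -> exists ft, local_extension smooth_on A f x ft.

End Regularity.

(* Derivative of f relative to [0, T], hence one-sided at 0 and at T. *)
Definition is_derive_itv {R : realType} {W : normedModType R}
    (T : R) (f : R -> W) (t : R) (d : W) :=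
  (s - t)^-1 *: (f s - f t) @[s --> within `[0, T] t^'] --> d.

Section Geometry.
Context {R : realType}.
Notation E := 'rV[R]_3.

(* The library norm on row vectors is the sup norm. *)
Definition dot (x y : E) : R := \sum_(i < 3) x 0 i * y 0 i.
Definition enorm (x : E) : R := Num.sqrt (dot x x).

Definition grad (f : E -> R) (x : E) : E := \row_i 'D_(delta_mx 0 i) f x.

Definition smooth_hypersurface (G : set E) :=
  forall x, G x -> exists (U : set E) (rho : E -> R^o),
    [/\ open U, U x, smooth_on U rho,
        forall y, U y -> (G y <-> rho y = 0)
      & forall y, U y -> G y -> grad rho y != 0].

Definition tangent (G : set E) (x tau : E) :=
  exists gamma : R^o -> E,
    [/\ gamma 0 = x, \forall s \near 0, G (gamma s)
      & is_derive (0 : R^o) 1 gamma tau].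

Definition unit_normal (G : set E) (x n : E) :=
  enorm n = 1 /\ forall tau, tangent G x tau -> dot n tau = 0.

Definition oriented (G : set E) :=
  exists n : E -> E,
    {within G, continuous n} /\ forall x, G x -> unit_normal G x (n x).

(* The exterior of a closed hypersurface is the unbounded part of its
   complement. *)
Definition exterior (G : set E) : set E :=
  [set y | (~` G) y /\ ~ bounded_set (connected_component (~` G) y)].

Definition unit_outward_normal (G : set E) (x n : E) :=
  unit_normal G x n /\ \forall s \near 0^'+, exterior G (x + s *: n).

Definition diffeomorphism (A B : set E) (f : E -> E) :=
  [/\ f @` A = B, smooth_set A f
    & exists g : E -> E, smooth_set B g /\ forall x, A x -> g (f x) = x].

(* The matrix I - n (x) n, symmetric and acting on row vectors. *)
Definition tangential_projection (n : E) : 'M[R]_3 := 1%:M - n^T *m n.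

End Geometry.

Section EvolvingSurface.
Context {R : realType}.
Notation E := 'rV[R]_3.
Variables (Gamma0 : set E) (T : R) (Phi : E * R -> E).

Definition surface (t : R) : set E := [set Phi (X, t) | X in Gamma0].

(* The closed space-time surface; its points are pairs (x, t). *)
Definition spacetime : set (E * R) :=
  [set z | 0 <= z.2 <= T /\ surface z.2 z.1].

(* A hypersurface in the sense above has no boundary, so "closed" is
   compactness. *)
Record evolving_surface (v : E * R -> E) : Prop := {
  es_compact : compact Gamma0;
  es_connected : connected Gamma0;
  es_hypersurface : smooth_hypersurface Gamma0;
  es_oriented : oriented Gamma0;
  es_time : 0 < T;
  es_smooth : smooth_set (Gamma0 `*` `[0, T]) Phi;
  es_init : forall X, Gamma0 X -> Phi (X, 0) = X;
  es_slice : forall t : R, 0 <= t <= T ->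
    smooth_hypersurface (surface t) /\
    diffeomorphism Gamma0 (surface t) (fun X => Phi (X, t));
  es_flow : forall (X : E) (t : R), Gamma0 X -> 0 <= t <= T ->
    is_derive_itv T (fun s => Phi (X, s)) t (v (Phi (X, t), t));
  es_velocity : C1_set spacetime v
}.

Definition material_derivative (f : E * R -> R^o) (z : E * R) (d : R) :=
  exists X, [/\ Gamma0 X, Phi (X, z.2) = z.1
    & is_derive_itv T (fun s => f (Phi (X, s), s)) z.2 (d : R^o)].

(* A relation because it goes through an extension ft off the surface; the
   projection makes g independent of the choice of ft. *)
Definition tangential_gradient (nu : E * R -> E) (f : E * R -> R^o)
    (z : E * R) (g : E) :=
  exists ft, local_extension C1_on spacetime f z ft /\
    g = grad (fun x => ft (x, z.2)) z.1 *m tangential_projection (nu z).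

Definition hamiltonian_regular (H : E * R -> E -> R) (L1 L2 : R) :=
  (forall z w p, spacetime z -> spacetime w ->
     `|H z p - H w p| <=
       L1 * (enorm (z.1 - w.1) + `|z.2 - w.2|) * (1 + enorm p)) /\
  (forall z p q, spacetime z ->
     `|H z p - H z q| <= L2 * enorm (p - q)).

(* Semicontinuity on the closed space-time surface: [subspace spacetime] carries
   the induced topology there (and its other points are isolated). *)
Definition LSC (u : E * R -> R) :=
  lower_semicontinuous (fun z : subspace spacetime => (u z)%:E).
Definition USC (u : E * R -> R) := LSC (fun z => - u z).

Definition locally_bounded (u : E * R -> R) :=
  forall z, spacetime z ->
    bounded_near (u : E * R -> R^o) (within spacetime (nbhs z)).

Definition local_max (f : E * R -> R) (z : E * R) :=
  \forall w \near within spacetime (nbhs z), f w <= f z.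
Definition local_min (f : E * R -> R) (z : E * R) :=
  \forall w \near within spacetime (nbhs z), f z <= f w.

Definition viscosity_subsolution (nu : E * R -> E) (H : E * R -> E -> R)
    (u0 : E -> R) (u : E * R -> R) :=
  [/\ locally_bounded u, USC u,
      forall x, surface 0 x -> u (x, 0) <= u0 x
    & forall phi : E * R -> R^o, C1_set spacetime phi ->
      forall z, spacetime z -> 0 < z.2 ->
      local_max (fun w => u w - phi w) z ->
      forall d g, material_derivative phi z d ->
        tangential_gradient nu phi z g -> d + H z g <= 0].

Definition viscosity_supersolution (nu : E * R -> E) (H : E * R -> E -> R)
    (u0 : E -> R) (u : E * R -> R) :=
  [/\ locally_bounded u, LSC u,
      forall x, surface 0 x -> u0 x <= u (x, 0)
    & forall phi : E * R -> R^o, C1_set spacetime phi ->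
      forall z, spacetime z -> 0 < z.2 ->
      local_min (fun w => u w - phi w) z ->
      forall d g, material_derivative phi z d ->
        tangential_gradient nu phi z g -> 0 <= d + H z g].

Definition viscosity_solution (nu : E * R -> E) (H : E * R -> E -> R)
    (u0 : E -> R) (u : E * R -> R) :=
  viscosity_subsolution nu H u0 u /\ viscosity_supersolution nu H u0 u.

End EvolvingSurface.

(* Main.v *)
(* Two solutions are compared by doubling the variables: one maximizes
   u1(x,t) - u2(y,s) - lam t - k |x-y|^2 - k^2 (t-s)^2 over pairs of points of
   the closed space-time surface. The penalty at the maximum tends to 0 along
   k = 2^n, and since the ambient Euclidean penalty is smooth it is a test
   function for both equations. With q = 2k(x-y) the velocity terms differ by
   at most C |q| (|x-y| + |t-s|). The Hamiltonians see the tangential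
   projections of q at (x,t) and (y,s), but these are close to q: a chord of
   the surface satisfies |nu(x,t).(x-y)| <= C (|x-y|^2 + |t-s|). This follows
   from a second-order Taylor expansion of the flow map, because nu kills the
   images of the tangent vectors of Gamma0, and from Gronwall's inequality,
   which bounds the distance of two labels by the distance of their positions
   at time t. The weight k^2 on (t-s)^2 makes k |t-s| tend to 0, so all error
   terms vanish in the limit, contradicting lam > 0. *)

Require Import Defs.
From HB Require Import structures.
From mathcomp Require Import all_boot all_order all_algebra.
From mathcomp Require Import all_classical all_reals all_analysis.
From mathcomp Require Import ring lra.

Set Implicit Arguments.
Unset Strict Implicit.
Unset Printing Implicit Defensive.

Import Order.TTheory GRing.Theory Num.Theory.
Import numFieldNormedType.Exports.

Local Open Scope classical_set_scope.
Local Open Scope ring_scope.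

(** * Mean value and Taylor estimates in coordinates *)

Section Calculus.
Context {R : realType}.

(** A form of finite dimension that passes to products: a spanning family whose coordinate
    functionals have norm at most 1, as sup and max norms provide. It covers the space-time [E * R],
    on which the flow map lives. *)
Definition has_coordinates (V : normedModType R) :=
  exists (I : finType) (e : I -> V) (c : I -> V -> R),
    [/\ forall x, x = \sum_i c i x *: e i, forall i, scalar (c i)
      & forall i x, `|c i x| <= `|x|].

Lemma row_norm_le n (x : 'rV[R]_n) B :
  0 <= B -> (forall i, `|x 0 i| <= B) -> `|x| <= B.
Proof.
move=> B0 xB; rewrite -[`|x|]/(mx_norm x) mx_normrE; apply: bigmax_le => //.
by move=> [i j] _ /=; rewrite (ord1 i); exact: xB.
Qed.

Lemma coord_le_norm n (x : 'rV[R]_n) i : `|x 0 i| <= `|x|.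
Proof.
rewrite -[`|x|]/(mx_norm x) mx_normrE.
exact: (le_bigmax 0 (fun ij : 'I_1 * 'I_n => `|x ij.1 ij.2|) (0, i)).
Qed.

Lemma row_coordinates n : has_coordinates 'rV[R]_n.+1.
Proof.
exists 'I_n.+1, (fun i => delta_mx 0 i), (fun i (x : 'rV_n.+1) => x 0 i); split.
- exact: row_sum_delta.
- by move=> i a x y; rewrite !mxE.
- by move=> i x; exact: coord_le_norm.
Qed.

Lemma real_coordinates : has_coordinates R^o.
Proof.
exists unit, (fun=> 1), (fun=> id); split => // x.
by rewrite big_const /= card_unit /= addr0 -[LHS]mulr1.
Qed.

Lemma pair_coordinates (V W : normedModType R) :
  has_coordinates V -> has_coordinates W -> has_coordinates (V * W)%type.
Proof.
move=> [I [e [c [ec cl cb]]]] [J [e' [c' [ec' cl' cb']]]].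
exists (I + J)%type,
  (fun k => match k with inl i => (e i, 0) | inr j => (0, e' j) end),
  (fun k x => match k with inl i => c i x.1 | inr j => c' j x.2 end); split.
- move=> x; rewrite big_sumType /=.
  have -> : \sum_(i : I) c i x.1 *: (e i, 0 : W) = (x.1, 0).
    rewrite [in RHS](ec x.1); elim/big_rec2: _ => // i y1 y2 _ ->.
    by congr pair => /=; rewrite scaler0 add0r.
  have -> : \sum_(j : J) c' j x.2 *: (0 : V, e' j) = (0, x.2).
    rewrite [in RHS](ec' x.2); elim/big_rec2: _ => // i y1 y2 _ ->.
    by congr pair => /=; rewrite scaler0 add0r.
  by case: x => a b; congr pair; rewrite /= ?addr0 ?add0r.
- by move=> [i|j] a x y /=; rewrite (cl, cl').
- move=> [i|j] x; rewrite prod_normE le_max; apply/orP; [left|right].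
  + exact: cb.
  + exact: cb'.
Qed.

Lemma scalarfB (V : normedModType R) (c : V -> R) x y :
  scalar c -> c (x - y) = c x - c y.
Proof. by move=> cl; rewrite addrC -scaleN1r cl mulN1r addrC. Qed.

Lemma scalarfZ (V : normedModType R) (c : V -> R) a x :
  scalar c -> c (a *: x) = a * c x.
Proof.
move=> cl; have c0 : c 0 = 0 by rewrite -(subrr x) scalarfB// subrr.
by rewrite -[a *: x]addr0 cl c0 addr0.
Qed.

Lemma scalarf_continuous (V : normedModType R) (c : V -> R) :
  scalar c -> (forall w, `|c w| <= `|w|) -> continuous (c : V -> R^o).
Proof.
move=> cl cb.
pose cL : {linear V -> R^o} := HB.pack c (GRing.isLinear.Build _ _ _ _ c cl).
apply: (linear_bounded_continuous cL).1.
apply/linear_boundedP; near=> r => w.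
rewrite (le_trans (cb w))// ler_peMl//; near: r; exact: nbhs_pinfty_ge.
Unshelve. all: by end_near. Qed.

Lemma derive_functional (V W : normedModType R) (c : W -> R) (f : V -> W) x v :
  scalar c -> (forall w, `|c w| <= `|w|) -> derivable f x v ->
  is_derive x v (c \o f : V -> R^o) (c ('D_v f x)).
Proof.
move=> cl cb df.
have cc := scalarf_continuous cl cb.
have key : h^-1 *: (((c \o f) \o shift x) (h *: v) - (c \o f) x)
     @[h --> 0^'] --> (c ('D_v f x) : R^o).
  have -> : (fun h : R => h^-1 *: (((c \o f) \o shift x) (h *: v) - (c \o f) x))
     = c \o (fun h => h^-1 *: ((f \o shift x) (h *: v) - f x)).
    apply/funext => h /=; by rewrite (scalarfZ _ _ cl) (scalarfB _ _ cl).
  have df' : h^-1 *: ((f \o shift x) (h *: v) - f x) @[h --> 0^'] --> 'D_v f x.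
    exact: df.
  exact: (cvg_comp _ _ df' (cc ('D_v f x))).
by apply: DeriveDef; [apply: cvgP key | apply: cvg_lim key].
Qed.

(** There is no mean value equality for vector values, so a functional [c] is applied first; what
    remains is the scalar theorem along the segment. The intermediate point depends on [c]. *)
Lemma mean_value_functional (V W : normedModType R) (c : W -> R) (f : V -> W) x y :
  scalar c -> (forall w, `|c w| <= `|w|) ->
  (forall s : R, 0 <= s <= 1 -> differentiable f (x + s *: (y - x))) ->
  exists2 s : R, 0 <= s <= 1 &
    c (f y) - c (f x) = c ('D_(y - x) f (x + s *: (y - x))).
Proof.
move=> cl cb df.
pose g s : R := c (f (x + s *: (y - x))).
have dg s : 0 <= s <= 1 ->
    is_derive (s : R) 1 g (c ('D_(y - x) f (x + s *: (y - x)))).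
  move=> s01.
  have := derive_functional (v := y - x) cl cb (diff_derivable (df s s01)).
  have E : (fun h : R => h^-1 *: ((g \o shift s) (h *: 1) - g s)) =
     (fun h => h^-1 *: (((c \o f) \o shift (x + s *: (y - x))) (h *: (y - x))
         - (c \o f) (x + s *: (y - x)))).
    apply/funext => h; rewrite /g /= /shift /=.
    congr (_ *: (c (f _) - _)).
    by rewrite [h *: 1]mulr1 scalerDl addrCA.
  case=> d1 d2; split; first by rewrite /derivable E.
  by rewrite /derive E.
have [|s||s] := @MVT_segment R g
  (fun s => c ('D_(y - x) f (x + s *: (y - x)))) 0 1.
- exact: ler01.
- by rewrite in_itv/= => /andP[s0 s1]; apply: dg; rewrite !ltW.
- apply: derivable_within_continuous => s; rewrite in_itv/= => s01.
  by have [] := dg s s01.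
rewrite in_itv/= => s01; rewrite subr0 mulr1 => E.
exists s => //; rewrite -E /g scale1r scale0r addr0 addrCA subrr addr0 //.
Qed.

End Calculus.

(** * Local Lipschitz and second-order Taylor bounds *)

Section LipschitzTaylor.
Context {R : realType}.

Lemma near_norm_ball (V : normedModType R) (x0 : V) (P : set V) :
  (\forall x \near x0, P x) ->
  \forall r \near 0^'+, forall x, `|x - x0| < r -> P x.
Proof.
move=> /nbhs_normP[e /= e0 eP]; near=> r => x xr; apply: eP => /=.
rewrite distrC (lt_le_trans xr)//; near: r.
exact: nbhs_right_le.
Unshelve. all: by end_near. Qed.

Lemma segment_norm_lt (V : normedModType R) (x0 x y : V) (r s : R) :
  `|x - x0| < r -> `|y - x0| < r -> 0 <= s <= 1 ->
  `|x + s *: (y - x) - x0| < r.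
Proof.
move=> xr yr /andP[s0 s1].
have -> : x + s *: (y - x) - x0 = (1 - s) *: (x - x0) + s *: (y - x0).
  have -> : y - x = (y - x0) - (x - x0) by rewrite opprB addrA addrNK.
  by rewrite scalerBr scalerBl scale1r addrAC [in RHS]addrAC addrA.
rewrite (le_lt_trans (ler_normD _ _))// !normrZ (ger0_norm s0).
rewrite ger0_norm ?subr_ge0//.
have [->|sn0] := eqVneq s 0; first by rewrite subr0 mul1r mul0r addr0.
have s_gt0 : 0 < s by rewrite lt_neqAle eq_sym sn0.
have : s * `|y - x0| < s * r by rewrite ltr_pM2l.
have : (1 - s) * `|x - x0| <= (1 - s) * r.
  by rewrite ler_wpM2l ?subr_ge0// ltW.
lra.
Qed.

(** Recovers a norm bound from bounds on functionals, each of which may come from its own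
    intermediate point. *)
Lemma norm_functional_le (W : normedModType R) : has_coordinates W ->
  exists2 M, 0 <= M & forall (w1 w2 : W) B,
    (forall c : W -> R, scalar c -> (forall w, `|c w| <= `|w|) ->
       `|c w1 - c w2| <= B) -> `|w1 - w2| <= M * B.
Proof.
move=> [I [e [c [ec cl cb]]]]; exists (\sum_i `|e i|).
  by apply: sumr_ge0.
move=> w1 w2 B H; rewrite (ec (w1 - w2)) mulr_suml.
apply: (le_trans (ler_norm_sum _ _ _)); apply: ler_sum => i _.
rewrite normrZ mulrC ler_wpM2l// scalarfB//.
exact: H.
Qed.

Section Local.
Context {V W : normedModType R}.
Hypotheses (hV : has_coordinates V) (hW : has_coordinates W).

(** Continuity bounds the finitely many derivatives along the [e i] near [x0], and linearity of the
    differential extends this to all directions. *)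
Lemma derive_bound (U : set V) (f : V -> W) x0 :
  open U -> U x0 -> C1_on U f ->
  exists2 B, 0 <= B & \forall x \near x0, forall v, `|'D_v f x| <= B * `|v|.
Proof.
move=> oU Ux0 fC1; have [I [e [c [ec cl cb]]]] := hV.
exists (\sum_i (`|'D_(e i) f x0| + 1)).
  by apply: sumr_ge0 => i _; rewrite addr_ge0.
have bd : \forall x \near x0, forall i, `|'D_(e i) f x| < `|'D_(e i) f x0| + 1.
  apply: filter_forall => i.
  have cn := (fC1 x0 Ux0).2 (e i).
  have : (fun y => `|'D_(e i) f y|) @ x0 --> `|'D_(e i) f x0| by exact: cvg_norm.
  move/cvgr_lt; apply; by rewrite ltrDl.
have Ux : \forall x \near x0, U x by exact: open_nbhs_nbhs.
near=> x => v.
have dx : differentiable f x by apply: (fC1 x _).1; near: x.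
have bdx : forall i, `|'D_(e i) f x| < `|'D_(e i) f x0| + 1 by near: x.
rewrite deriveE// {1}(ec v) linear_sum mulr_suml.
apply: (le_trans (ler_norm_sum _ _ _)); apply: ler_sum => i _.
rewrite linearZ/= normrZ mulrC ler_pM// -deriveE//.
exact: ltW.
Unshelve. all: by end_near. Qed.

Lemma C1_local_lipschitz (U : set V) (f : V -> W) x0 :
  open U -> U x0 -> C1_on U f ->
  exists2 B, 0 <= B & \forall r \near 0^'+, forall x y,
    `|x - x0| < r -> `|y - x0| < r ->  `|f y - f x| <= B * `|y - x|.
Proof.
move=> oU Ux0 fC1; have [B B0 dB] := derive_bound oU Ux0 fC1.
have [M M0 hM] := norm_functional_le hW.
exists (M * B); first exact: mulr_ge0.
have Ux : \forall x \near x0, U x by exact: open_nbhs_nbhs.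
near=> r => x y xr yr.
have rP z : `|z - x0| < r -> U z /\ forall v, `|'D_v f z| <= B * `|v|.
  by move: z; near: r; exact: near_norm_ball (filterI Ux dB).
rewrite -mulrA; apply: hM => c cl cb.
have [s s01|s s01 ->] := mean_value_functional (f := f) (x := x) (y := y) cl cb.
  by have [/fC1[]] := rP _ (segment_norm_lt xr yr s01).
apply: (le_trans (cb _)).
by have [_] := rP _ (segment_norm_lt xr yr s01); apply.
Unshelve. all: by end_near. Qed.

(** By the mean value theorem the remainder is the difference of the derivatives along [y - x] at
    two points of the segment. Each derivative along [e i] is Lipschitz, which yields the second
    factor of [|y - x|]. *)
Lemma taylor_quadratic (U : set V) (f : V -> W) x0 :
  open U -> U x0 -> C1_on U f -> (forall v, C1_on U ('D_v f)) ->
  exists2 B, 0 <= B & \forall r \near 0^'+, forall x y,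
    `|x - x0| < r -> `|y - x0| < r ->
    `|f y - f x - 'D_(y - x) f x| <= B * `|y - x| ^+ 2.
Proof.
move=> oU Ux0 fC1 dfC1.
have [I [e [c [ec cl cb]]]] := hV.
have [M M0 hM] := norm_functional_le hW.
have Ux : \forall x \near x0, U x by exact: open_nbhs_nbhs.
have /choice[B BP] : forall i : I, exists B, 0 <= B /\
    \forall r \near 0^'+, forall x y, `|x - x0| < r -> `|y - x0| < r ->
      `|'D_(e i) f y - 'D_(e i) f x| <= B * `|y - x|.
  move=> i; have [B B0 BP] := C1_local_lipschitz oU Ux0 (dfC1 (e i)).
  by exists B.
exists (M * \sum_i B i).
  by rewrite mulr_ge0// sumr_ge0// => i _; have [] := BP i.
have BP' : \forall r \near 0^'+, forall i, forall x y, `|x - x0| < r ->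
    `|y - x0| < r -> `|'D_(e i) f y - 'D_(e i) f x| <= B i * `|y - x|.
  by apply: filter_forall => i; have [] := BP i.
near=> r => x y xr yr.
have rB i a b : `|a - x0| < r -> `|b - x0| < r ->
    `|'D_(e i) f b - 'D_(e i) f a| <= B i * `|b - a|.
  by move: i a b; near: r.
have rU z : `|z - x0| < r -> U z.
  by move: z; near: r; exact: near_norm_ball Ux.
have dD z : `|z - x0| < r -> differentiable f z by move=> /rU /fC1[].
rewrite -mulrA; apply: hM => c' cl' cb'.
rewrite (scalarfB (f y) (f x) cl').
have [s s01|s s01 ->] :=
    mean_value_functional (f := f) (x := x) (y := y) cl' cb'.
  exact/dD/segment_norm_lt.
rewrite -(scalarfB _ _ cl'); apply: (le_trans (cb' _)).
set z := x + _; have zr : `|z - x0| < r by exact: segment_norm_lt.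
have zx : `|z - x| <= `|y - x|.
  have /andP[s0 s1] := s01.
  by rewrite /z addrAC subrr add0r normrZ ger0_norm// ler_piMl.
have dE w : `|w - x0| < r -> 'D_(y - x) f w = \sum_i c i (y - x) *: 'D_(e i) f w.
  move=> /dD dw; rewrite deriveE// {1}(ec (y - x)) linear_sum.
  by apply: eq_bigr => i _; rewrite linearZ/= deriveE.
rewrite !dE// -sumrB mulr_suml.
apply: (le_trans (ler_norm_sum _ _ _)); apply: ler_sum => i _.
rewrite -scalerBr normrZ.
rewrite expr2 mulrA [leRHS]mulrC ler_pM//.
apply: (le_trans (rB _ _ _ xr zr)); rewrite ler_wpM2l//.
by have [] := BP i.
Unshelve. all: by end_near. Qed.
End Local.
End LipschitzTaylor.

(** * From local to global bounds on compact sets *)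

Section CompactBounds.
Context {R : realType}.

(** Pairs close to each other are handled by a covering of the diagonal; for pairs at distance at
    least [r] the bound [M] suffices, as [(|y - x| / r) ^ n >= 1]. *)
Lemma compact_power_bound (V : normedModType R) (K : set V) (g : V -> V -> R) M n :
  compact K -> (forall x y, K x -> K y -> g x y <= M) ->
  (forall x0, K x0 -> exists2 B, 0 <= B & \forall r \near 0^'+, forall x y,
     K x -> K y -> `|x - x0| < r -> `|y - x0| < r ->
     g x y <= B * `|y - x| ^+ n) ->
  exists2 B, 0 <= B & forall x y, K x -> K y -> g x y <= B * `|y - x| ^+ n.
Proof.
move=> /compact_near_coveringP cK gM gloc.
(* The single parameter controls the distance and, through its inverse, the constant, so shrinking
   it serves both. *)
pose P (r : R) x := K x -> forall y, K y -> `|y - x| < r ->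
  g x y <= r^-1 * `|y - x| ^+ n.
have : \forall r \near 0^'+, K `<=` P r.
  apply: cK => x0 Kx0; have [B B0 BP] := gloc _ Kx0.
  have [r [r0 rP]] : exists r : R, 0 < r /\ forall x y,
     K x -> K y -> `|x - x0| < r -> `|y - x0| < r -> g x y <= B * `|y - x| ^+ n.
    near (0 : R)^'+ => r; exists r; split; first by [].
    by near: r.
  have nx : \forall x \near x0, `|x - x0| < r / 2.
    apply/nbhs_normP; exists (r / 2) => /=; first exact: divr_gt0.
    by move=> x /=; rewrite distrC.
  (* The first condition keeps [y] in the ball of radius [r] about [x0]; the second gives
     [B <= d^-1]. *)
  have nd : \forall d \near 0^'+, (0 < d < r / 2) && (d * (B + 1) < 1).
    near=> d; apply/andP; split; [apply/andP; split|].
    - by [].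
    - near: d; apply: nbhs_right_lt; exact: divr_gt0.
    - rewrite -ltr_pdivlMr ?ltr_wpDl// mul1r; near: d; apply: nbhs_right_lt.
      by rewrite invr_gt0 ltr_wpDl.
  exists ([set x | `|x - x0| < r / 2],
     [set d | (0 < d < r / 2) && (d * (B + 1) < 1)]); first by split.
  move=> -[x d] /= [xr /andP[/andP[d0 dr] dB]] Kx y Ky yx.
  have yr : `|y - x0| < r.
    rewrite [r]splitr -(subrK x y) -addrA (le_lt_trans (ler_normD _ _))//.
    by rewrite ltrD// (lt_trans yx).
  apply: (le_trans (rP _ _ Kx Ky _ yr)).
    by rewrite (lt_le_trans xr)// ler_pdivrMr// ler_peMr// ?ltW// ltr1n.
  rewrite ler_wpM2r ?exprn_ge0// -[leRHS]mul1r ler_pdivlMr//.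
  by apply: ltW; rewrite (le_lt_trans _ dB)// mulrC ler_wpM2l ?lerDl// ltW.
move=> Pr; near (0 : R)^'+ => r.
have r0 : 0 < r by [].
have rP : K `<=` P r by near: r.
exists (r^-1 + `|M| * r^-1 ^+ n) => [|x y Kx Ky].
  by rewrite addr_ge0 ?mulr_ge0 ?exprn_ge0 ?invr_ge0 // ltW.
have [yx|yx] := ltP `|y - x| r.
  apply: (le_trans (rP x Kx Kx y Ky yx)).
  by rewrite ler_wpM2r ?exprn_ge0// lerDl mulr_ge0// exprn_ge0// invr_ge0 ltW.
apply: (le_trans (gM _ _ Kx Ky)); rewrite mulrDl -mulrA -exprMn.
apply: (@le_trans _ _ (`|M| * (r^-1 * `|y - x|) ^+ n)).
  apply: (le_trans (ler_norm _)); rewrite ler_peMr// exprn_ege1//.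
  by rewrite mulrC ler_pdivlMr// mul1r.
by rewrite lerDr mulr_ge0 ?exprn_ge0 ?invr_ge0 // ltW.
Unshelve. all: by end_near. Qed.

Lemma C1_set_continuous (V W : normedModType R) (K : set V) (f : V -> W) :
  C1_set K f -> {within K, continuous f}.
Proof.
move=> fC1; apply/subspace_continuousP => x Kx.
have [ft [U [oU Ux ftC1 ftf]]] := fC1 x Kx.
have cft : ft @ within K (nbhs x) --> f x.
  rewrite -(ftf x Kx Ux).
  apply: cvg_within_filter; apply: differentiable_continuous.
  by have [] := ftC1 x Ux.
apply: cvg_trans cft; apply: near_eq_cvg; rewrite near_withinE.
have Un : \forall y \near x, U y by exact: open_nbhs_nbhs.
by apply: filterS Un => y Uy Ky; rewrite ftf.
Qed.

Lemma compact_bound (V W : normedModType R) (K : set V) (f : V -> W) :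
  compact K -> {within K, continuous f} ->
  exists M, forall x, K x -> `|f x| <= M.
Proof.
move=> cK fc; have /compact_bounded[M [_ MP]] := continuous_compact fc cK.
exists (M + 1) => x Kx; apply: (MP (M + 1)); first by rewrite ltrDl.
by exists x.
Qed.

(** [K] need not be convex: locally the segments run through the open set where an extension is C1,
    and compactness gives one constant for all pairs. *)
Lemma C1_set_lipschitz (V W : normedModType R) (K : set V) (f : V -> W) :
  has_coordinates V -> has_coordinates W -> compact K -> C1_set K f ->
  exists2 B, 0 <= B & forall x y, K x -> K y -> `|f y - f x| <= B * `|y - x|.
Proof.
move=> hV hW cK fC1.
have [M MP] := compact_bound cK (C1_set_continuous fC1).
apply: (@compact_power_bound _ K (fun x y => `|f y - f x|) (M + M) 1) => //.
  by move=> x y Kx Ky; rewrite (le_trans (ler_normB _ _))// lerD ?MP.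
move=> x0 Kx0; have [ft [U [oU Ux0 ftC1 ftf]]] := fC1 _ Kx0.
have [B B0 BP] := C1_local_lipschitz hV hW oU Ux0 ftC1; exists B => //.
have Ux : \forall x \near x0, U x by exact: open_nbhs_nbhs.
near=> r => x y Kx Ky xr yr.
have rU z : `|z - x0| < r -> U z.
  by move: z; near: r; exact: near_norm_ball Ux.
rewrite expr1 -!ftf; [|by [] |exact: rU|by []|exact: rU].
by move: x y xr yr {Kx Ky}; near: r.
Unshelve. all: by end_near. Qed.

Lemma smooth_onC1 (V W : normedModType R) (U : set V) (f : V -> W) :
  smooth_on U f -> C1_on U f.
Proof.
move=> fs x Ux; split; first exact: (fs [::]).
by move=> v; apply: differentiable_continuous; exact: (fs [:: v]).
Qed.

Lemma smooth_on_derive (V W : normedModType R) (U : set V) (f : V -> W) v :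
  smooth_on U f -> smooth_on U ('D_v f).
Proof. by move=> fs vs x Ux; exact: (fs (v :: vs)). Qed.

Lemma smooth_setC1 (V W : normedModType R) (K : set V) (f : V -> W) :
  smooth_set K f -> C1_set K f.
Proof.
move=> fs x /fs[ft [U [oU Ux fts ftf]]].
by exists ft, U; split => //; exact: smooth_onC1.
Qed.

End CompactBounds.

(** * The evolving surface *)

Section Dot.
Context {R : realType}.
Notation E := 'rV[R]_3.
Implicit Types x y z : E.

Lemma dotC x y : dot x y = dot y x.
Proof. by apply: eq_bigr => i _; rewrite mulrC. Qed.

Lemma dot_linear x a y z : dot x (a *: y + z) = a * dot x y + dot x z.
Proof.
by rewrite /dot mulr_sumr -big_split; apply: eq_bigr => i _; rewrite !mxE /=; ring.
Qed.

Lemma dotZr x a y : dot x (a *: y) = a * dot x y.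
Proof. by rewrite /dot mulr_sumr; apply: eq_bigr => i _; rewrite !mxE; ring. Qed.

Lemma dotZl x a y : dot (a *: y) x = a * dot y x.
Proof. by rewrite dotC dotZr dotC. Qed.

Lemma dotDr x y z : dot x (y + z) = dot x y + dot x z.
Proof. by rewrite -[y]scale1r dot_linear mul1r scale1r. Qed.

Lemma dotDl x y z : dot (y + z) x = dot y x + dot z x.
Proof. by rewrite dotC dotDr !(dotC x). Qed.

Lemma dotNr x y : dot x (- y) = - dot x y.
Proof. by rewrite -scaleN1r dotZr mulN1r. Qed.

Lemma dotNl x y : dot (- y) x = - dot y x.
Proof. by rewrite dotC dotNr dotC. Qed.

Lemma dotBr x y z : dot x (y - z) = dot x y - dot x z.
Proof. by rewrite dotDr dotNr. Qed.

Lemma dot_ge0 x : 0 <= dot x x.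
Proof. by apply: sumr_ge0 => i _; rewrite -expr2 sqr_ge0. Qed.

Lemma norm_dot_le x y : `|dot x y| <= 3 * `|x| * `|y|.
Proof.
apply: (le_trans (ler_norm_sum _ _ _)).
have -> : 3 * `|x| * `|y| = \sum_(i < 3) `|x| * `|y|.
  by rewrite sumr_const card_ord -mulrA mulr_natl.
by apply: ler_sum => i _; rewrite normrM ler_pM// coord_le_norm.
Qed.

Lemma sqr_norm_le_dot x : `|x| ^+ 2 <= dot x x.
Proof.
have h i : x 0 i ^+ 2 <= dot x x.
  rewrite /dot (bigD1 i)//= -expr2 lerDl sumr_ge0// => j _.
  by rewrite -expr2 sqr_ge0.
rewrite -(@ler_pXn2r _ 2) ?nnegrE ?exprn_ge0 ?dot_ge0//.
rewrite ler_pXn2r ?nnegrE ?exprn_ge0 ?dot_ge0//.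
rewrite -[leRHS]sqr_sqrtr ?dot_ge0// ler_pXn2r ?nnegrE ?sqrtr_ge0//.
apply: row_norm_le; first exact: sqrtr_ge0.
by move=> i; rewrite -sqrtr_sqr ler_wsqrtr.
Qed.

Lemma dot_eq0 x : dot x x = 0 -> x = 0.
Proof.
move=> x0; have := sqr_norm_le_dot x; rewrite x0 => h.
by apply/eqP; rewrite -normr_eq0 -sqrf_eq0 eq_le h sqr_ge0.
Qed.

Lemma norm_le_enorm x : `|x| <= enorm x.
Proof.
by rewrite -[leLHS]ger0_norm// -sqrtr_sqr ler_wsqrtr// sqr_norm_le_dot.
Qed.

Lemma enorm_le x : enorm x <= 2 * `|x|.
Proof.
rewrite -[leRHS]ger0_norm ?mulr_ge0// -sqrtr_sqr ler_wsqrtr//.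
have := norm_dot_le x x; have := ler_norm (dot x x).
have := normr_ge0 x; rewrite -!mulrA -expr2 exprMn; nra.
Qed.

End Dot.

(** * Tangent vectors of a level set *)

Section Tangent.
Context {R : realType}.
Notation E := 'rV[R]_3.

Lemma derive_lin (V W : normedModType R) (f : V -> W) x a u w :
  differentiable f x -> 'D_(a *: u + w) f x = a *: 'D_u f x + 'D_w f x.
Proof. by move=> df; rewrite !deriveE// linearP. Qed.

(** The line [X + s tau] is brought back to the level set by a correction [h n] in the transversal
    direction: there [rho] equals [h N] up to a quadratic error in the displacement, so a root [h]
    of order [s^2] exists. *)
Lemma tangent_level_set (G U : set E) (rho : E -> R^o) X n tau :
  open U -> U X -> smooth_on U rho -> (forall y, U y -> (G y <-> rho y = 0)) ->
  G X -> 0 < 'D_n rho X -> 'D_tau rho X = 0 -> tangent G X tau.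
Proof.
move=> oU UX rs Grho GX N0 tau0.
set N : R := 'D_n rho X in N0.
have dr : differentiable rho X by have [] := smooth_onC1 rs UX.
have [B B0 BP] := taylor_quadratic (row_coordinates 2) real_coordinates
  oU UX (smooth_onC1 rs) (fun v => smooth_onC1 (smooth_on_derive v rs)).
have nU : \forall x \near X, U x by exact: open_nbhs_nbhs.
have [r [r0 rU rB]] : exists r : R, [/\ 0 < r, forall w, `|w| < r -> U (X + w)
    & forall w, `|w| < r -> `|rho (X + w) - 'D_w rho X| <= B * `|w| ^+ 2].
  near (0 : R)^'+ => r.
  have XwX w : X + w - X = w by rewrite addrAC subrr add0r.
  have r0 : 0 < r by [].
  exists r; split => // w wr.
    have : `|X + w - X| < r by rewrite XwX.
    by move: (X + w); near: r; exact: near_norm_ball nU.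
  have rP : forall x y, `|x - X| < r -> `|y - X| < r ->
    `|rho y - rho x - 'D_(y - x) rho x| <= B * `|y - x| ^+ 2 by near: r.
  have := rP X (X + w); rewrite subrr normr0 XwX (Grho _ UX).1// subr0; exact.
(* Chosen so that [K s^2 N] equals the Taylor error bound for a displacement of length
   [|s| (|tau| + 1)]. *)
pose K : R := B * (`|tau| + 1) ^+ 2 / N.
have K0 : 0 <= K by rewrite divr_ge0 ?mulr_ge0 ?exprn_ge0 ?addr_ge0// ltW.
have t1 : 0 < `|tau| + 1 by rewrite ltr_wpDl.
(* For [|s| < q^-1] the correction adds at most [|s|] to the displacement, and the displacement
   stays below [r]. *)
pose q : R := K * `|n| + 1 + (`|tau| + 1) / r.
have q0 : 0 < q by rewrite addr_gt0 ?divr_gt0// ltr_wpDl// mulr_ge0.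
have wle (s h : R) : `|s| < q^-1 -> `|h| <= K * s ^+ 2 ->
    `|s *: tau + h *: n| <= `|s| * (`|tau| + 1).
  rewrite -[q^-1]mul1r ltr_pdivlMr// => sq hK.
  rewrite (le_trans (ler_normD _ _))// !normrZ mulrDr mulr1 lerD2l.
  apply: (@le_trans _ _ (K * s ^+ 2 * `|n|)); first by rewrite ler_wpM2r.
  have -> : K * s ^+ 2 * `|n| = (`|s| * (K * `|n|)) * `|s|.
    by rewrite -[s ^+ 2]real_normK ?num_real// expr2; ring.
  rewrite ler_piMl//; apply: ltW; apply: le_lt_trans sq.
  by rewrite ler_wpM2l// /q -addrA lerDl addr_ge0// divr_ge0// ltW.
have wr (s : R) : `|s| < q^-1 -> `|s| * (`|tau| + 1) < r.
  rewrite -[q^-1]mul1r ltr_pdivlMr// => sq.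
  rewrite -[r]mul1r -ltr_pdivrMr// -mulrA (le_lt_trans _ sq)// ler_wpM2l//.
  by rewrite /q lerDr addr_ge0// mulr_ge0.
have dw s h : 'D_(s *: tau + h *: n) rho X = h * N.
  by rewrite derive_lin// tau0 scaler0 add0r deriveE// linearZ/= -deriveE.
have /choice[h hP] : forall s : R, exists h : R, `|s| < q^-1 ->
    `|h| <= K * s ^+ 2 /\ rho (X + (s *: tau + h *: n)) = 0.
  (* Outside the small range of [s] the value of [h] is arbitrary. *)
  move=> s; have [sq|] := ltP `|s| q^-1; last by exists 0.
  have Ks : 0 <= K * s ^+ 2 by rewrite mulr_ge0// sqr_ge0.
  pose f (h : R) : R := rho (X + (s *: tau + h *: n)).
  (* At the endpoints [e = - K s^2] and [e = K s^2] this forces [f] to be nonpositive and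
     nonnegative respectively. *)
  have bnd e : `|e| <= K * s ^+ 2 -> `|f e - e * N| <= K * s ^+ 2 * N.
    move=> eK; rewrite -(dw s) (le_trans (rB _ _))//.
      by rewrite (le_lt_trans (wle _ _ _ eK))// wr.
    rewrite /K mulrAC divfK ?gt_eqF// -mulrA ler_wpM2l// -[s ^+ 2]real_normK ?num_real//.
    apply: (@le_trans _ _ ((`|s| * (`|tau| + 1)) ^+ 2)).
      by rewrite lerXn2r ?nnegrE ?mulr_ge0 ?(ltW t1)// wle.
    by rewrite exprMn [leLHS]mulrC.
  have [|||e] := @IVT _ f (- (K * s ^+ 2)) (K * s ^+ 2) 0.
  - by apply: (le_trans _ Ks); rewrite oppr_le0.
  - apply: continuous_in_subspaceT => e; rewrite inE/= in_itv/= -ler_norml => eK.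
    have c1 : (fun e => X + (s *: tau + e *: n)) @ e --> X + (s *: tau + e *: n).
      apply: cvgD; first exact: cvg_cst.
      apply: cvgD; first exact: cvg_cst.
      by apply: cvgZr_tmp; exact: cvg_id.
    have [dre _] := smooth_onC1 rs (rU _ (le_lt_trans (wle _ _ sq eK) (wr _ sq))).
    exact: (cvg_comp _ _ c1 (differentiable_continuous dre)).
  - have := bnd (K * s ^+ 2); rewrite ger0_norm// lexx => /(_ isT).
    have := bnd (- (K * s ^+ 2)); rewrite normrN ger0_norm// lexx => /(_ isT).
    rewrite !ler_norml => /andP[h1 h2] /andP[h3 h4].
    rewrite ge_min le_max; apply/andP; split; apply/orP; [left|right]; lra.
  by rewrite in_itv/= -ler_norml => eK fe; exists e.
have h0 : h 0 = 0.
  have [] := hP 0; first by rewrite normr0 invr_gt0.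
  by rewrite expr0n mulr0 normr_le0 => /eqP.
have g0 : X + (0 *: tau + h 0 *: n) = X by rewrite h0 !scale0r !addr0.
(* The implicit function is only needed at one point, so h comes from the
   intermediate value theorem and is differentiable at 0 as h = O(s^2). *)
exists (fun s : R => X + (s *: tau + h s *: n)); split; first exact: g0.
  apply/nbhs_normP; exists q^-1 => /=; first by rewrite invr_gt0.
  move=> s /=; rewrite sub0r normrN => sq; have [hK hz] := hP s sq.
  apply/Grho => //; apply: rU.
  by rewrite (le_lt_trans (wle _ _ sq hK))// wr.
have key : s^-1 *: (((fun s : R => X + (s *: tau + h s *: n)) \o shift (0 : R))
      (s *: (1 : R^o)) - (X + (0 *: tau + h 0 *: n))) @[s --> (0:R)^'] --> tau.
  apply/cvgrPdist_le => e e0.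
  have near_s : \forall s \near (0:R)^', `|s| < e / (K * `|n| + 1).
    apply: nbhs_dnbhs; apply/nbhs_normP; exists (e / (K * `|n| + 1)) => /=.
      by rewrite divr_gt0// ltr_wpDl// mulr_ge0.
    by move=> s /=; rewrite sub0r normrN.
  have near_q : \forall s \near (0:R)^', `|s| < q^-1.
    apply: nbhs_dnbhs; apply/nbhs_normP; exists q^-1 => /=.
      by rewrite invr_gt0.
    by move=> s /=; rewrite sub0r normrN.
  near=> s.
  have s0 : s != 0 by near: s; exact: nbhs_dnbhs_neq.
  have sq : `|s| < q^-1 by near: s.
  have se : `|s| < e / (K * `|n| + 1) by near: s.
  have [hK _] := hP s sq.
  rewrite g0 /shift/= addr0 [s *: 1]mulr1 [X + _]addrC addrK scalerDr scalerA.
  rewrite mulVf// scale1r opprD addrA subrr sub0r normrN scalerA normrZ normrM normfV.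
  apply: (@le_trans _ _ (`|s| * (K * `|n| + 1))); last first.
    rewrite -ler_pdivlMr; last by rewrite ltr_wpDl// mulr_ge0.
    exact: ltW.
  have s1 : 0 < `|s| by rewrite normr_gt0.
  rewrite mulrDr mulr1 -[leLHS]addr0 lerD// mulrA ler_wpM2r//.
  rewrite mulrC ler_pdivrMr// mulrAC -expr2 mulrC real_normK ?num_real//.
split; first exact: cvgP key.
exact: cvg_lim key.
Unshelve. all: by end_near. Qed.

End Tangent.

(** * Calculus of derivatives relative to the time interval *)

Section DeriveItv.
Context {R : realType}.
Variable T : R.
Notation E := 'rV[R]_3.

Lemma is_derive_itv_cvg (W : normedModType R) (p : R -> W) t d :
  is_derive_itv T p t d -> p s @[s --> within `[0, T] t^'] --> p t.
Proof.
move=> dp; rewrite -[p t]add0r -(scale0r d).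
have c0 : (s - t) @[s --> within `[0, T] (t : R)^'] --> (0 : R).
  apply: cvg_within_filter.
  have ci : s @[s --> (t : R)^'] --> (t : R) by exact: nbhs_dnbhs.
  have : (s - t) @[s --> (t : R)^'] --> (t - t : R) by exact: (cvgB ci (cvg_cst t)).
  by rewrite subrr.
have c1 : (s - t) *: ((s - t)^-1 *: (p s - p t)) + p t
    @[s --> within `[0, T] (t : R)^'] --> 0 *: d + p t.
  by apply: cvgD; [exact: cvgZ c0 dp|exact: cvg_cst].
apply: cvg_trans c1; apply: near_eq_cvg.
rewrite near_withinE; near=> s => _; have st : s != t by near: s; exact: nbhs_dnbhs_neq.
by rewrite /= scalerA mulfV ?subr_eq0// scale1r subrK.
Unshelve. all: by end_near. Qed.

Lemma is_derive_itvD (W : normedModType R) (p q : R -> W) t d e :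
  is_derive_itv T p t d -> is_derive_itv T q t e ->
  is_derive_itv T (fun s => p s + q s) t (d + e).
Proof.
move=> dp dq; rewrite /is_derive_itv.
under eq_fun do rewrite opprD addrACA scalerDr.
exact: cvgD dp dq.
Qed.

Lemma is_derive_itvZ (W : normedModType R) (p : R -> W) t d (a : R) :
  is_derive_itv T p t d -> is_derive_itv T (fun s => a *: p s) t (a *: d).
Proof.
move=> dp; rewrite /is_derive_itv.
under eq_fun do rewrite -scalerBr scalerA mulrC -scalerA.
exact: cvgZl_tmp dp.
Qed.

Lemma is_derive_itv_cst (W : normedModType R) (x : W) t :
  is_derive_itv T (fun=> x) t 0.
Proof.
rewrite /is_derive_itv; under eq_fun do rewrite subrr scaler0.
exact: cvg_cst.
Qed.

Lemma is_derive_itv_id t : is_derive_itv T (fun s => s : R^o) t 1.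
Proof.
have c1 : (1 : R^o) @[_ --> within `[0, T] (t : R)^'] --> (1 : R^o) by exact: cvg_cst.
apply: cvg_trans c1; apply: near_eq_cvg.
rewrite near_withinE; near=> s => _; have st : s != t by near: s; exact: nbhs_dnbhs_neq.
by rewrite /= /GRing.scale/= mulVf ?subr_eq0.
Unshelve. all: by end_near. Qed.

Lemma is_derive_itvB (W : normedModType R) (p q : R -> W) t d e :
  is_derive_itv T p t d -> is_derive_itv T q t e ->
  is_derive_itv T (fun s => p s - q s) t (d - e).
Proof.
move=> dp /(@is_derive_itvZ _ _ _ _ (-1)) dq.
have := is_derive_itvD dp dq; rewrite scaleN1r.
by under eq_fun do rewrite scaleN1r.
Qed.

Lemma cvg_dot (X : Type) (F : set_system X) {FF : Filter F} (p q : X -> E) x y :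
  p @ F --> x -> q @ F --> y -> dot (p z) (q z) @[z --> F] --> dot x y.
Proof.
move=> px qy.
have co (r : X -> E) (z : E) (i : 'I_3) : r @ F --> z -> (r s 0 i) @[s --> F] --> z 0 i.
  move=> rz; exact: (cvg_comp _ _ rz (@coord_continuous R 1 3 0 i z)).
rewrite /dot !big_ord_recl big_ord0.
under eq_fun do rewrite !big_ord_recl big_ord0.
apply: cvgD; first by apply: cvgM; exact: co.
apply: cvgD; first by apply: cvgM; exact: co.
apply: cvgD; first by apply: cvgM; exact: co.
exact: cvg_cst.
Qed.

(** The increment factors as [dot (p s + p t) (p s - p t)], and [p] is continuous at [t] within the
    interval. *)
Lemma is_derive_itv_dot (p : R -> E) t d :
  is_derive_itv T p t d ->
  is_derive_itv T (fun s => dot (p s) (p s) : R^o) t (2 * dot (p t) d).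
Proof.
move=> dp; have pc := is_derive_itv_cvg dp.
have key : dot (p s + p t) ((s - t)^-1 *: (p s - p t))
    @[s --> within `[0, T] t^'] --> dot (p t + p t) d.
  by apply: cvg_dot; [apply: cvgD; [exact: pc|exact: cvg_cst]|exact: dp].
rewrite (_ : 2 * _ = dot (p t + p t) d); last by rewrite dotDl mulrDl mul1r.
apply: cvg_trans key; apply: near_eq_cvg; apply: nearW => s /=.
rewrite dotZr dotBr !dotDl (dotC (p t) (p s)) /GRing.scale/=; ring.
Qed.

Lemma is_derive_itv_sqr (f : R -> R^o) t d :
  is_derive_itv T f t d ->
  is_derive_itv T (fun s => f s ^+ 2 : R^o) t (2 * f t * d).
Proof.
move=> df; have fc := is_derive_itv_cvg df.
have key : (f s + f t) * ((s - t)^-1 * (f s - f t))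
    @[s --> within `[0, T] t^'] --> (f t + f t) * d.
  apply: cvgM; last exact: df.
  by apply: cvgD; [exact: fc|exact: cvg_cst].
rewrite (_ : 2 * _ * d = (f t + f t) * d); last by rewrite mulrDl mul1r.
apply: cvg_trans key; apply: near_eq_cvg; apply: nearW => s /=.
by rewrite /GRing.scale/=; ring.
Qed.

(** Around an interior time the interval contains a full neighbourhood. This gives access to
    monotonicity criteria stated with ordinary derivatives. *)
Lemma is_derive_itv_interior (f : R -> R^o) t d :
  0 < t < T -> is_derive_itv T f t d -> is_derive t 1 f d.
Proof.
move=> /andP[t0 tT] df.
have sh : (h *: (1 : R) + t) @[h --> (0:R)^'] --> within `[0, T] t^'.
  move=> P; rewrite /= /within/= => /nbhs_ballP[e /= e0 eP].
  rewrite /nbhs/=; near=> h.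
  have h0 : h != 0 by near: h; exact: nbhs_dnbhs_neq.
  have hb : `|h| < Num.min e (Num.min t (T - t)).
    near: h; apply: nbhs_dnbhs; apply/nbhs_normP.
    exists (Num.min e (Num.min t (T - t))) => /=.
      by rewrite !lt_min e0 t0 subr_gt0.
    by move=> s /=; rewrite sub0r normrN.
  move: hb; rewrite !lt_min => /and3P[he ht hT].
  apply: eP; rewrite /= [h *: 1]mulr1.
  - by rewrite /ball/= opprD addrCA subrr addr0 normrN.
  - by rewrite -subr_eq0 addrK.
  - rewrite in_itv/=; move: ht hT; rewrite !ltr_norml => /andP[? ?] /andP[? ?].
    apply/andP; split; lra.
have key : h^-1 *: ((f \o shift t) (h *: (1:R)) - f t) @[h --> (0:R)^'] --> d.
  apply: cvg_trans (cvg_comp _ _ sh df); apply: near_eq_cvg.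
  by apply: nearW => h /=; rewrite addrK [h *: 1]mulr1.
split; [exact: cvgP key|exact: cvg_lim key].
Unshelve. all: by end_near. Qed.

End DeriveItv.

(** * Metric estimates for the flow and for chords of the surface *)

Section EvolvingGeometry.
Context {R : realType}.
Notation E := 'rV[R]_3.
Variables (Gamma0 : set E) (T : R) (Phi : E * R -> E) (v nu : E * R -> E).
Hypothesis hsurf : evolving_surface Gamma0 T Phi v.
Hypothesis hnu : forall z, spacetime Gamma0 T Phi z ->
  unit_outward_normal (surface Gamma0 Phi z.2) z.1 (nu z).

Let hE := @row_coordinates R 2.
Let hER := pair_coordinates hE (@real_coordinates R).
Let K : set (E * R) := Gamma0 `*` `[0, T].

Let K_compact : compact K.
Proof. by apply: compact_setX; [exact: es_compact hsurf|exact: segment_compact]. Qed.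

Let Phi_C1 : C1_set K Phi := smooth_setC1 (es_smooth hsurf).

Lemma spacetime_flow X t : Gamma0 X -> 0 <= t <= T ->
  spacetime Gamma0 T Phi (Phi (X, t), t).
Proof. by move=> GX t0T; split => //=; exists X. Qed.

(** It is the continuous image of the compact cylinder [K] under [(X, t) |-> (Phi (X, t), t)]. *)
Lemma spacetime_compact : compact (spacetime Gamma0 T Phi).
Proof.
have -> : spacetime Gamma0 T Phi = (fun z => (Phi z, z.2)) @` K.
  apply/seteqP; split => [[x t] [/= t0T [X GX <-]]|_ [[X t] [/= GX tT] <-]].
    by exists (X, t) => //; split => //=; rewrite in_itv.
  by apply: spacetime_flow; rewrite // -in_itv.
apply: continuous_compact K_compact.
apply/subspace_continuousP => z Kz.
have c1 : Phi @ within K (nbhs z) --> Phi z.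
  by have /subspace_continuousP := C1_set_continuous Phi_C1; apply.
have c2 : snd @ within K (nbhs z) --> z.2 by apply: cvg_within_filter; exact: cvg_snd.
exact: (cvg_pair c1 c2).
Qed.

Lemma velocity_lipschitz : exists2 L, 0 <= L &
  forall z w, spacetime Gamma0 T Phi z -> spacetime Gamma0 T Phi w ->
    `|v w - v z| <= L * `|w - z|.
Proof. exact: C1_set_lipschitz hER hE spacetime_compact (es_velocity hsurf). Qed.

Lemma flow_lipschitz : exists2 L, 0 <= L &
  forall z w, K z -> K w -> `|Phi w - Phi z| <= L * `|w - z|.
Proof. exact: C1_set_lipschitz hER hE K_compact Phi_C1. Qed.

Let pair_fst_norm (x y : E) (t : R) : `|(x, t) - (y, t)| = `|x - y|.
Proof.
rewrite prod_normE/= subrr normr0; exact/max_idPl.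
Qed.

Let pair_snd_norm (x : E) (t s : R) : `|(x, t) - (x, s)| = `|t - s|.
Proof. by rewrite prod_normE/= subrr normr0; exact/max_idPr. Qed.

Lemma flow_cvg X s : Gamma0 X -> 0 <= s <= T ->
  Phi (X, s') @[s' --> within `[0, T] (nbhs s)] --> Phi (X, s).
Proof.
move=> GX s0T; have [B B0 hB] := flow_lipschitz.
apply/cvgrPdist_le => e e0; rewrite near_withinE.
apply/nbhs_normP; exists (e / (B + 1)) => /=.
  by rewrite divr_gt0// ltr_wpDl.
move=> s' /= s'e s'T; apply: (le_trans (hB (X, s') (X, s) _ _)).
- by split.
- by split => //=; rewrite in_itv.
rewrite pair_snd_norm; move: s'e; rewrite ltr_pdivlMr ?ltr_wpDl// => s'e.
by apply: ltW; rewrite (le_lt_trans _ s'e)// mulrC ler_wpM2l// lerDl.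
Qed.

(* Gronwall: the squared distance f of two trajectories has f' >= - 6 L f. *)
Lemma flow_inverse_lipschitz : exists2 C, 0 <= C &
  forall X Y t, Gamma0 X -> Gamma0 Y -> 0 <= t <= T ->
    `|X - Y| ^+ 2 <= C * `|Phi (X, t) - Phi (Y, t)| ^+ 2.
Proof.
have [L L0 hL] := velocity_lipschitz; have [B B0 hB] := flow_lipschitz.
exists (3 * expR (6 * L * T)); first by rewrite mulr_ge0 ?expR_ge0.
move=> X Y t GX GY t0T.
pose p s := Phi (X, s) - Phi (Y, s).
pose dp s := v (Phi (X, s), s) - v (Phi (Y, s), s).
pose f (s : R) : R := dot (p s) (p s).
have T0 := es_time hsurf.
have pd s : 0 <= s <= T -> is_derive_itv T p s (dp s).
  by move=> s0T; apply: is_derive_itvB; exact: es_flow hsurf _ _ _ _.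
have fd s : 0 < s < T -> is_derive s 1 (f : R -> R^o) (2 * dot (p s) (dp s)).
  move=> s0T; apply: (is_derive_itv_interior s0T); apply: is_derive_itv_dot.
  by apply: pd; case/andP: s0T => ? ?; rewrite !ltW.
have fd_ge s : 0 <= s <= T -> - (6 * L * f s) <= 2 * dot (p s) (dp s).
  move=> s0T.
  have dple : `|dp s| <= L * `|p s|.
    apply: (le_trans (hL _ _ (spacetime_flow GY s0T) (spacetime_flow GX s0T))).
    by rewrite pair_fst_norm.
  have h1 := norm_dot_le (p s) (dp s).
  have h2 : - dot (p s) (dp s) <= 3 * L * f s.
    rewrite -dotNr (le_trans (ler_norm _))// dotNr normrN (le_trans h1)//.
    apply: (@le_trans _ _ (3 * L * `|p s| ^+ 2)); last first.
      by rewrite ler_wpM2l ?mulr_ge0// sqr_norm_le_dot.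
    have -> : 3 * L * `|p s| ^+ 2 = 3 * `|p s| * (L * `|p s|) by ring.
    by rewrite ler_wpM2l// mulr_ge0.
  have -> : 6 * L * f s = 2 * (3 * L * f s) by ring.
  lra.
(* The integrating factor turns the lower bound on [f'] into monotonicity of [g], so [g 0 <= g t]
   bounds the initial distance by the one at time [t]. *)
pose g (s : R) : R := expR (6 * L * s) * f s.
have ed (s : R) : is_derive s 1 (fun s : R => expR (6 * L * s) : R^o)
    (6 * L * expR (6 * L * s)).
  have lin : is_derive s 1 (fun s : R => 6 * L * s) (6 * L).
    by apply: is_derive_eq; rewrite /GRing.scale/= mulr1.
  have := is_derive1_comp (is_derive_expR (6 * L * s)) lin.
  by rewrite [expR _ * _]mulrC.
have gd s : 0 < s < T -> is_derive s 1 (g : R -> R^o)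
   (expR (6 * L * s) * (2 * dot (p s) (dp s)) + f s * (6 * L * expR (6 * L * s))).
  move=> s0T; exact: (is_deriveM (ed s) (fd s s0T)).
have ec : continuous (fun s : R => expR (6 * L * s)).
  move=> s; apply: continuous_comp; last exact: continuous_expR.
  exact: mulrl_continuous.
(* [g] is differentiated at interior times only; continuity carries monotonicity to the
   endpoints. *)
have gc : {within `[0, T], continuous g}.
  apply/subspace_continuousP => s; rewrite /= in_itv/= => s0T.
  have c1 : expR (6 * L * s') @[s' --> within `[0, T] (nbhs s)] --> expR (6 * L * s).
    exact: (cvg_within_filter _ (ec s)).
  have pc : p s' @[s' --> within `[0, T] (nbhs s)] --> p s.
    by apply: cvgB; exact: flow_cvg.
  exact: (cvgM c1 (cvg_dot pc pc)).
have g0t : g 0 <= g t.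
  have [t0 tT] := andP t0T.
  apply: (@ger0_derive1_ndecr R g 0 T _ _ gc 0 t (lexx 0) t0 tT).
  - by move=> s; rewrite in_itv/= => /gd[].
  - move=> s; rewrite in_itv/= => s0T; have [d1 d2] := gd s s0T.
    rewrite derive1E d2; have := fd_ge s; case/andP: s0T => s0 sT.
    rewrite (ltW s0) (ltW sT) => /(_ isT); have := expR_gt0 (6 * L * s); nra.
have g0 : g 0 = dot (X - Y) (X - Y).
  by rewrite /g /f /p mulr0 expR0 mul1r !(es_init hsurf).
rewrite -/(p t); apply: (le_trans (sqr_norm_le_dot _)); rewrite -g0.
apply: (le_trans g0t); rewrite /g.
have fle : f t <= 3 * `|p t| ^+ 2.
  by rewrite expr2 mulrA (le_trans (ler_norm _))// norm_dot_le.
rewrite (_ : 3 * _ * _ = expR (6 * L * T) * (3 * `|p t| ^+ 2)); last by ring.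
apply: ler_pM => //; rewrite ?expR_ge0 ?dot_ge0//.
by rewrite ler_expR ler_wpM2l ?mulr_ge0//; case/andP: t0T.
Qed.

(** The flow pushes a curve in [Gamma0] forward to a curve in the surface at time [t]. The chain
    rule is applied to the extension [Ft], which agrees with [Phi] along the curve. *)
Lemma tangent_flow X t tau U (Ft : E * R -> E) :
  Gamma0 X -> 0 <= t <= T -> tangent Gamma0 X tau ->
  open U -> U (X, t) -> differentiable Ft (X, t) ->
  (forall z, K z -> U z -> Ft z = Phi z) ->
  tangent (surface Gamma0 Phi t) (Phi (X, t)) ('D_((tau, 0) : E * R) Ft (X, t)).
Proof.
move=> GX t0T [gamma [g0 gG dg]] oU UX dF FPhi.
have Kt Y : Gamma0 Y -> K (Y, t) by move=> GY; split => //=; rewrite in_itv.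
exists (fun s => Phi (gamma s, t)); split.
- by rewrite g0.
- by near=> s; exists (gamma s) => //; near: s.
have dgam : differentiable gamma (0 : R^o).
  by apply/derivable1_diffP; have [] := dg.
have dpair : is_diff (0 : R^o) (fun s : R^o => (gamma s, t))
    (fun s => ('d gamma (0 : R^o) s, 0)).
  by apply: is_diff_pair; exact: differentiableP.
have key : is_derive (0 : R^o) 1 (fun s : R^o => Ft (gamma s, t))
    ('D_((tau, 0) : E * R) Ft (X, t)).
  have dF' : differentiable Ft (gamma 0, t) by rewrite g0.
  have [dp1 dp2] := dpair.
  have dcomp := differentiable_comp dp1 dF'.
  split; first exact: diff_derivable dcomp.
  have [_ dv] := dg.
  by rewrite deriveE// diff_comp// dp2 /= -(deriveE _ dgam) dv g0 deriveE// -g0.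
have nU : \forall s \near (0 : R^o), U (gamma s, t).
  have c : (fun s : R^o => (gamma s, t)) @ (0 : R^o) --> (gamma 0, t).
    exact: (cvg_pair (differentiable_continuous dgam) (cvg_cst t)).
  by apply: c; rewrite g0; exact: open_nbhs_nbhs.
apply: near_eq_is_derive key.
by near=> s; apply: FPhi; [apply: Kt; near: s|near: s].
Unshelve. all: by end_near. Qed.

Lemma nu_norm z : spacetime Gamma0 T Phi z -> enorm (nu z) = 1.
Proof. by move=> /hnu[[]]. Qed.

Lemma nu_norm_le1 z : spacetime Gamma0 T Phi z -> `|nu z| <= 1.
Proof. by move=> Sz; rewrite -(nu_norm Sz) norm_le_enorm. Qed.

Lemma nu_tangent z tau : spacetime Gamma0 T Phi z ->
  tangent (surface Gamma0 Phi z.2) z.1 tau -> dot (nu z) tau = 0.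
Proof. by move=> /hnu[[_ +] _]; apply. Qed.

(** To first order the chord is the image of [Y - X] under the derivative of the flow. As [rho]
    vanishes at [X] and [Y], the vector [Y - X] is tangent to [Gamma0] up to a quadratic error, and
    the normal kills the image of its tangent part. *)
Lemma chord_normal_local z0 : K z0 -> exists2 B, 0 <= B &
  \forall r \near 0^'+, forall X Y t, Gamma0 X -> Gamma0 Y -> 0 <= t <= T ->
    `|(X, t) - z0| < r -> `|(Y, t) - z0| < r ->
    `|dot (nu (Phi (X, t), t)) (Phi (Y, t) - Phi (X, t))| <= B * `|Y - X| ^+ 2.
Proof.
move=> Kz0.
have [Ft [U [oU Uz0 Fs FPhi]]] := es_smooth hsurf Kz0.
have [W [rho [oW Wx0 rs Grho gradN0]]] := es_hypersurface hsurf Kz0.1.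
set n0 := grad rho z0.1.
have dr := (smooth_onC1 rs Wx0).1.
have N0 : 0 < 'D_n0 rho z0.1.
  have -> : 'D_n0 rho z0.1 = dot n0 n0.
    have n0i i : n0 0 i = 'D_(delta_mx 0 i) rho z0.1 by rewrite mxE.
    rewrite deriveE// [in LHS](row_sum_delta n0) linear_sum.
    by apply: eq_bigr => i _; rewrite linearZ/= -deriveE// -n0i.
  rewrite lt_neqAle dot_ge0 andbT eq_sym; apply/eqP => /dot_eq0/eqP.
  by apply/negP; apply: gradN0 => //; exact: Kz0.1.
have [B1 B10 T1] := taylor_quadratic hER hE oU Uz0 (smooth_onC1 Fs)
  (fun u => smooth_onC1 (smooth_on_derive u Fs)).
have [B2 B20 D2] := derive_bound hER oU Uz0 (smooth_onC1 Fs).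
have [B3 B30 T3] := taylor_quadratic hE real_coordinates oW Wx0 (smooth_onC1 rs)
  (fun u => smooth_onC1 (smooth_on_derive u rs)).
(* The fixed direction [n0] stays transversal near [z0.1] with a uniform bound, so no normal varying
   with the point is required. *)
have nN : \forall x \near z0.1, 'D_n0 rho z0.1 / 2 < 'D_n0 rho x.
  have := (smooth_onC1 rs Wx0).2 n0; move/cvgr_gt; apply.
  by rewrite ltr_pdivrMr// ltr_pMr// ltr1n.
have nW : \forall x \near z0.1, W x by exact: open_nbhs_nbhs.
have nU : \forall z \near z0, U z by exact: open_nbhs_nbhs.
set N := 'D_n0 rho z0.1 in N0 nN.
(* The first summand is the Taylor remainder of the flow; the second is the image of the non-tangent
   part [a n0] of [Y - X]. The factors 3 come from [norm_dot_le]. *)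
exists (3 * B1 + 3 * (B2 * (B3 / (N / 2) * `|n0|))).
  by rewrite addr_ge0 ?mulr_ge0 ?invr_ge0 ?mulr_ge0 ?invr_ge0 // ltW.
near=> r => X Y t GX GY t0T Xr Yr.
have r_fst x : `|(x, t) - z0| < r -> `|x - z0.1| < r.
  by rewrite prod_normE gt_max/= => /andP[].
have rU z : `|z - z0| < r -> U z /\ forall u, `|'D_u Ft z| <= B2 * `|u|.
  by move: z; near: r; exact: near_norm_ball (filterI nU D2).
have rW x : `|x - z0.1| < r -> W x /\ N / 2 < 'D_n0 rho x.
  by move: x; near: r; exact: near_norm_ball (filterI nW nN).
have rT1 z w : `|z - z0| < r -> `|w - z0| < r ->
    `|Ft w - Ft z - 'D_(w - z) Ft z| <= B1 * `|w - z| ^+ 2.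
  by move: z w; near: r.
have rT3 x y : `|x - z0.1| < r -> `|y - z0.1| < r ->
    `|rho y - rho x - 'D_(y - x) rho x| <= B3 * `|y - x| ^+ 2.
  by move: x y; near: r.
have Kt x : Gamma0 x -> K (x, t) by move=> Gx; split => //=; rewrite in_itv.
have [WX NX] := rW _ (r_fst _ Xr); have [WY _] := rW _ (r_fst _ Yr).
have [UX DX] := rU _ Xr; have [UY _] := rU _ Yr.
have dX : `|'D_(Y - X) rho X| <= B3 * `|Y - X| ^+ 2.
  have := rT3 _ _ (r_fst _ Xr) (r_fst _ Yr).
  by rewrite (Grho _ WX).1// (Grho _ WY).1// subrr sub0r normrN.
have drX := (smooth_onC1 rs WX).1.
(* The multiple of [n0] to be removed from [Y - X] to make [rho] stationary; its numerator is
   quadratically small by [dX]. *)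
pose a : R := 'D_(Y - X) rho X / 'D_n0 rho X.
pose tau := - a *: n0 + (Y - X).
have NX0 : 0 < 'D_n0 rho X by apply: lt_trans NX; rewrite divr_gt0.
have tau0 : 'D_tau rho X = 0.
  rewrite /tau derive_lin// /a scaleNr [_ *: _]mulfVK ?gt_eqF// addNr//.
have ha : `|a| <= B3 / (N / 2) * `|Y - X| ^+ 2.
  rewrite /a normrM normfV (gtr0_norm NX0) mulrAC ler_pM//.
    by rewrite invr_ge0 ltW.
  by rewrite lef_pV2 ?posrE ?divr_gt0// ltW.
have tt := tangent_level_set oW WX rs Grho GX NX0 tau0.
have dF := (smooth_onC1 Fs UX).1.
have tS := tangent_flow GX t0T tt oU UX dF FPhi.
have SX := spacetime_flow GX t0T.
have := nu_tangent SX tS; set nX := nu _ => nt.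
have nX1 : `|nX| <= 1 := nu_norm_le1 SX.
have YXE : (Y, t) - (X, t) = a *: (n0, 0 : R) + (tau, 0) :> E * R.
  congr pair => /=; last by rewrite subrr scaler0 addr0.
  by rewrite /tau addrA scaleNr addrN add0r.
rewrite -(FPhi _ (Kt _ GX) UX) -(FPhi _ (Kt _ GY) UY).
rewrite -(subrK ('D_((Y, t) - (X, t)) Ft (X, t)) (Ft (Y, t) - _)) dotDr.
rewrite (le_trans (ler_normD _ _))// mulrDl lerD//.
  rewrite (le_trans (norm_dot_le _ _))// -mulrA -mulrA ler_wpM2l//.
  rewrite -[leRHS]mul1r ler_pM// (le_trans (rT1 _ _ Xr Yr))//.
  by rewrite pair_fst_norm.
rewrite YXE derive_lin// dotDr nt addr0.
rewrite (le_trans (norm_dot_le _ _))// -mulrA -!mulrA ler_wpM2l//.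
rewrite -[leRHS]mul1r ler_pM// normrZ.
apply: (@le_trans _ _ (B3 / (N / 2) * `|Y - X| ^+ 2 * (B2 * `|n0|))).
  rewrite ler_pM//; apply: (le_trans (DX _)).
  by rewrite prod_normE/= normr0 (max_idPl _).
by rewrite le_eqVlt; apply/orP; left; apply/eqP; ring.
Unshelve. all: by end_near. Qed.

Lemma chord_normal : exists2 B, 0 <= B &
  forall X Y t, Gamma0 X -> Gamma0 Y -> 0 <= t <= T ->
    `|dot (nu (Phi (X, t), t)) (Phi (Y, t) - Phi (X, t))| <= B * `|Y - X| ^+ 2.
Proof.
have [M hM] := compact_bound K_compact (C1_set_continuous Phi_C1).
(* The time of [w] is ignored, so that an estimate at one common time becomes a two-point function
   on [K]. *)
pose g (z w : E * R) : R :=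
  `|dot (nu (Phi z, z.2)) (Phi (w.1, z.2) - Phi z)|.
have Kswap z w : K z -> K w -> K (w.1, z.2) by move=> [? ?] [? ?]; split.
have KS z : K z -> spacetime Gamma0 T Phi (Phi z, z.2).
  by case: z => X t [GX tT]; apply: spacetime_flow; rewrite // -in_itv.
have [|z0 Kz0|B B0 hB] := @compact_power_bound _ _ K g (3 * (M + M)) 2 K_compact.
- move=> z w Kz Kw; rewrite /g (le_trans (norm_dot_le _ _))// -mulrA ler_wpM2l//.
  rewrite -[leRHS]mul1r ler_pM// ?nu_norm_le1//; first exact: KS.
  by rewrite (le_trans (ler_normB _ _))// lerD// hM//; exact: Kswap.
- have [B B0 BP] := chord_normal_local Kz0; exists B => //.
  near=> r => -[X t] [Y s] [GX /= tT] [GY /= sT] Xr Yr.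
  have rP : forall X Y t, Gamma0 X -> Gamma0 Y -> 0 <= t <= T ->
    `|(X, t) - z0| < r -> `|(Y, t) - z0| < r ->
    `|dot (nu (Phi (X, t), t)) (Phi (Y, t) - Phi (X, t))| <= B * `|Y - X| ^+ 2.
    by near: r.
  rewrite /g/=; apply: (le_trans (rP _ _ _ GX GY _ Xr _)).
  + by move: tT; rewrite in_itv.
  + move: Xr Yr; rewrite !prod_normE !gt_max/= => /andP[_ ->] /andP[-> _] //.
  + rewrite ler_wpM2l// lerXn2r ?nnegrE// prod_normE le_max/= lexx//.
exists B => // X Y t GX GY t0T.
have tT : `[0, T]%classic t by rewrite /= in_itv.
have := hB (X, t) (Y, t) (conj GX tT) (conj GY tT).
by rewrite /g /= pair_fst_norm.
Unshelve. all: by end_near. Qed.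

(* Makes the tangential projection harmless on the gradient of the penalty,
   and replaces the Lipschitz continuity of nu. *)
Lemma normal_estimate : exists2 C, 0 <= C &
  forall z w, spacetime Gamma0 T Phi z -> spacetime Gamma0 T Phi w ->
    `|dot (nu z) (z.1 - w.1)| <= C * (`|z.1 - w.1| ^+ 2 + `|z.2 - w.2|).
Proof.
have [B B0 hB] := chord_normal.
have [C C0 hC] := flow_inverse_lipschitz.
have [L L0 hL] := flow_lipschitz.
exists (2 * B * C * (1 + L * L * T) + 3 * L).
  by rewrite addr_ge0 ?mulr_ge0 ?addr_ge0 ?mulr_ge0// ltW// (es_time hsurf).
move=> [x t] [y s] [/= t0T [X GX <-]] [/= s0T [Y GY <-]].
have KY r : 0 <= r <= T -> K (Y, r) by move=> r0T; split => //=; rewrite in_itv.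
(* The point [Phi (Y, t)] splits the chord into one at the common time [t] and a displacement of the
   label [Y] in time. *)
have b1 : `|Phi (Y, t) - Phi (Y, s)| <= L * `|t - s|.
  by rewrite (le_trans (hL _ _ (KY _ s0T) (KY _ t0T)))// pair_snd_norm.
have ts : `|t - s| <= T.
  by move: t0T s0T; rewrite ler_norml => /andP[? ?] /andP[? ?]; apply/andP; split; lra.
have SX := spacetime_flow GX t0T.
have p1 := hB X Y t GX GY t0T; have p2 := hC X Y t GX GY t0T.
have p3 : `|dot (nu (Phi (X, t), t)) (Phi (Y, t) - Phi (Y, s))| <= 3 * (L * `|t - s|).
  rewrite (le_trans (norm_dot_le _ _))// -mulrA ler_wpM2l//.
  by rewrite -[leRHS]mul1r ler_pM// nu_norm_le1.
have tri : `|Phi (X, t) - Phi (Y, t)| <=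
    `|Phi (X, t) - Phi (Y, s)| + `|Phi (Y, t) - Phi (Y, s)|.
  rewrite -[X in _ <= _ + X]normrN opprB (le_trans _ (ler_normD _ _))//.
  by rewrite addrA subrK.
have -> : dot (nu (Phi (X, t), t)) (Phi (X, t) - Phi (Y, s)) =
    - dot (nu (Phi (X, t), t)) (Phi (Y, t) - Phi (X, t)) +
    dot (nu (Phi (X, t), t)) (Phi (Y, t) - Phi (Y, s)).
  by rewrite -dotNr -dotDr opprB addrA subrK.
apply: (le_trans (ler_normD _ _)); rewrite normrN.
move: p1 p2 p3 tri b1 ts; rewrite [`|Y - X|]distrC.
set a := `|Phi (X, t) - Phi (Y, s)|; set b := `|Phi (Y, t) - Phi (Y, s)|.
set c := `|Phi (X, t) - Phi (Y, t)|; set d := `|X - Y|.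
set e := `|t - s|; move=> p1 p2 p3 tri b1 ts.
have [a0 b0 c0 e0] : [/\ 0 <= a, 0 <= b, 0 <= c & 0 <= e] by rewrite !normr_ge0.
(* Here [b^2 <= L^2 e^2], and [e <= T] trades one factor [e] for [T], leaving a term linear in the
   time difference. *)
have c2 : c ^+ 2 <= 2 * a ^+ 2 + 2 * (L * L * T * e).
  have : c ^+ 2 <= (a + b) ^+ 2 by rewrite lerXn2r ?nnegrE ?addr_ge0.
  have : b ^+ 2 <= L * L * T * e.
    apply: (@le_trans _ _ ((L * e) ^+ 2)).
      by rewrite lerXn2r ?nnegrE ?mulr_ge0.
    have -> : (L * e) ^+ 2 = L * L * (e * e) by ring.
    by rewrite -[leRHS]mulrA ler_wpM2l ?mulr_ge0// ler_wpM2r.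
  have := sqr_ge0 (a - b); nra.
have BC := mulr_ge0 B0 C0.
have q1 : B * d ^+ 2 <= B * C * (2 * a ^+ 2 + 2 * (L * L * T * e)).
  by rewrite -mulrA ler_wpM2l// (le_trans p2)// ler_wpM2l.
apply: (le_trans (lerD p1 p3)); apply: (le_trans (lerD q1 (lexx _))).
have LLT : 0 <= L * L * T by rewrite !mulr_ge0// ltW// (es_time hsurf).
have h1 : 0 <= B * C * e by rewrite mulr_ge0.
have h2 : 0 <= B * C * (L * L * T) * a ^+ 2 by rewrite mulr_ge0 ?sqr_ge0// mulr_ge0.
have h3 : 0 <= L * a ^+ 2 by rewrite mulr_ge0 ?sqr_ge0.
have -> : (2 * B * C * (1 + L * L * T) + 3 * L) * (a ^+ 2 + e) =
  B * C * (2 * a ^+ 2 + 2 * (L * L * T * e)) + 3 * (L * e) +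
  (2 * (B * C * e) + 2 * (B * C * (L * L * T) * a ^+ 2) + 3 * (L * a ^+ 2)).
  ring.
lra.
Qed.

End EvolvingGeometry.

(** * Doubling of variables *)

Section TestFunction.
Context {R : realType}.
Notation E := 'rV[R]_3.

Lemma functional_diff (V : normedModType R) (l : V -> R) (x : V) :
  scalar l -> (forall y, `|l y| <= `|y|) ->
  differentiable (l : V -> R^o) x /\ forall v, 'D_v (l : V -> R^o) x = l v.
Proof.
move=> ls lb; have di v : is_derive x v (l : V -> R^o) (l v).
  have := derive_functional (v := v) ls lb (@derivable_id _ _ x v).
  by rewrite derive_id.
split; last by move=> v; have [] := di v.
pose lL : {linear V -> R^o} := HB.pack l (GRing.isLinear.Build _ _ _ _ l ls).
apply: (@linear_differentiable _ _ _ lL).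
exact: scalarf_continuous ls lb.
Qed.

Lemma functional_square_diff (V : normedModType R) (l : V -> R) (k m : R) (x : V) :
  scalar l -> (forall y, `|l y| <= `|y|) ->
  differentiable (fun y => m * (l y - k) ^+ 2 : R^o) x /\
  forall v, 'D_v (fun y => m * (l y - k) ^+ 2 : R^o) x = 2 * m * (l x - k) * l v.
Proof.
move=> ls lb; have [dl Dl] := functional_diff x ls lb.
have d1 : differentiable (fun y => l y - k : R^o) x.
  by apply: differentiableB => //; exact: differentiable_cst.
have -> : (fun y => m * (l y - k) ^+ 2 : R^o) =
    (fun y => m * ((l y - k) * (l y - k))).
  by apply/funext => y; rewrite expr2.
have dsq : differentiable (fun y => (l y - k) * (l y - k) : R^o) x.
  exact: (differentiableM d1 d1).
split; first by apply: differentiableM => //; exact: differentiable_cst.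
move=> v.
have dv : is_derive x v (l : V -> R^o) (l v).
  by split; [exact: diff_derivable|exact: Dl].
have h1 : is_derive x v (fun y => l y - k : R^o) (l v - 0).
  exact: is_deriveB dv (is_derive_cst _ _ _).
have [_ E] := is_deriveM (is_derive_cst m x v) (is_deriveM h1 h1).
by rewrite [LHS]E /GRing.scale/= subr0; ring.
Qed.

(** One family for both equations: positive [c], [c2] and slope [al = lam] for the subsolution,
    negative [c], [c2] and [al = 0] for the supersolution. *)
Definition penalty_test (al c c2 : R) (a : E) (b : R) (w : E * R) : R^o :=
  al * w.2 + c * dot (w.1 - a) (w.1 - a) + c2 * (w.2 - b) ^+ 2.

Lemma penalty_test_diff al c c2 a b y :
  differentiable (penalty_test al c c2 a b) y /\
  forall v, 'D_v (penalty_test al c c2 a b) y =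
    al * v.2 + 2 * c * dot (y.1 - a) v.1 + 2 * c2 * (y.2 - b) * v.2.
Proof.
have snd_s : scalar (snd : E * R -> R) by [].
have snd_b (w : E * R) : `|w.2| <= `|w| by rewrite prod_normE le_max lexx orbT.
have fst_s i : scalar (fun w : E * R => w.1 0 i) by move=> k u w; rewrite /= !mxE.
have fst_b i (w : E * R) : `|w.1 0 i| <= `|w|.
  by rewrite prod_normE le_max coord_le_norm.
have [dt Dt] := functional_diff y snd_s snd_b.
have [dt2 Dt2] := functional_square_diff b c2 y snd_s snd_b.
have dX i := functional_square_diff (a 0 i) c y (fst_s i) (fst_b i).
have dal : differentiable (fun w : E * R => al * w.2 : R^o) y.
  by apply: differentiableM => //; exact: differentiable_cst.
have Dal v : 'D_v (fun w : E * R => al * w.2 : R^o) y = al * v.2.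
  by rewrite (@deriveZ _ _ R^o (snd : E * R -> R^o)) ?Dt//; exact: diff_derivable.
pose f i : E * R -> R^o := fun w => c * (w.1 0 i - a 0 i) ^+ 2.
have -> : penalty_test al c c2 a b = (fun w : E * R => al * w.2 : R^o) +
   (\sum_(i < 3) f i) + (fun w : E * R => c2 * (w.2 - b) ^+ 2 : R^o).
  apply/funext => w; rewrite /penalty_test !fctE fct_sumE /dot mulr_sumr.
  congr (_ + _ + _); apply: eq_bigr => i _.
  by rewrite /f !mxE expr2.
have ds : differentiable (\sum_(i < 3) f i) y.
  by apply: differentiable_sum => i; have [] := dX i.
have ds1 := differentiableD dal ds.
split; first exact: differentiableD ds1 dt2.
move=> v; rewrite !deriveD; try exact: diff_derivable.
rewrite Dal Dt2 derive_sum; last by move=> i; apply: diff_derivable; have [] := dX i.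
congr (_ + _ + _); rewrite /dot mulr_sumr; apply: eq_bigr => i _.
have [_ ->] := dX i; rewrite !mxE; ring.
Qed.

Lemma penalty_test_C1 al c c2 a b : C1_on setT (penalty_test al c c2 a b).
Proof.
move=> y _; have [dy _] := penalty_test_diff al c c2 a b y; split => // v.
have -> : (fun y => 'D_v (penalty_test al c c2 a b) y) = fun y =>
    al * v.2 + 2 * c * dot (y.1 - a) v.1 + 2 * c2 * (y.2 - b) * v.2.
  by apply/funext => z; have [_ ->] := penalty_test_diff al c c2 a b z.
have c1 : (z.1 - a) @[z --> y] --> y.1 - a.
  exact: (cvgB cvg_fst (cvg_cst a)).
have c2' : (z.2 - b) @[z --> y] --> y.2 - b.
  exact: (cvgB cvg_snd (cvg_cst b)).
have d1 : dot (z.1 - a) v.1 @[z --> y] --> dot (y.1 - a) v.1.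
  by apply: cvg_dot => //; exact: cvg_cst.
apply: cvgD; first (apply: cvgD; first exact: cvg_cst).
  by apply: cvgM => //; exact: cvg_cst.
by apply: cvgM; [apply: cvgM => //; exact: cvg_cst|exact: cvg_cst].
Qed.

Lemma penalty_test_extension al c c2 a b (A : set (E * R)) z :
  local_extension C1_on A (penalty_test al c c2 a b) z (penalty_test al c c2 a b).
Proof.
by exists setT; split => //; [exact: openT|exact: penalty_test_C1].
Qed.

Lemma penalty_test_C1_set al c c2 a b (A : set (E * R)) :
  C1_set A (penalty_test al c c2 a b).
Proof.
by move=> z Az; exists (penalty_test al c c2 a b); exact: penalty_test_extension.
Qed.

Lemma penalty_test_grad al c c2 a b z :
  grad (fun x => penalty_test al c c2 a b (x, z.2)) z.1 = (2 * c) *: (z.1 - a).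
Proof.
apply/rowP => i; rewrite mxE.
have -> : 'D_(delta_mx 0 i) (fun x => penalty_test al c c2 a b (x, z.2)) z.1 =
    'D_((delta_mx 0 i, 0) : E * R) (penalty_test al c c2 a b) z.
  set f := penalty_test _ _ _ _ _.
  have E : (fun h : R => h^-1 *: (((fun x => f (x, z.2)) \o shift z.1)
        (h *: delta_mx 0 i) - f (z.1, z.2))) =
      (fun h => h^-1 *: ((f \o shift z) (h *: (delta_mx 0 i, 0)) - f z)).
    apply/funext => h; rewrite /shift/= -surjective_pairing; congr (_ *: (f _ - _)).
    by congr pair; rewrite /= scaler0 add0r.
  by rewrite /derive E.
have [_ ->] := penalty_test_diff al c c2 a b z; rewrite /= !mulr0 add0r addr0.
rewrite mxE; congr (_ * _); rewrite /dot (bigD1 i)//= big1 ?addr0.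
  by rewrite !mxE !eqxx mulr1.
by move=> j ji; rewrite !mxE (negPf ji) andbF mulr0.
Qed.

(** For [q] a multiple of a chord and [n] the normal at one of its ends, the subtracted term is the
    one bounded by [normal_estimate]. *)
Lemma mul_tangential_projection (q n : E) :
  q *m tangential_projection n = q - dot q n *: n.
Proof.
rewrite /tangential_projection mulmxBr mulmx1 mulmxA; congr (_ - _).
apply/rowP => i; rewrite !mxE big_ord1 !mxE; congr (_ * _).
by apply: eq_bigr => j _; rewrite mxE.
Qed.

Lemma enormZ k (x : E) : enorm (k *: x) = `|k| * enorm x.
Proof.
by rewrite /enorm dotZl dotZr mulrA -expr2 sqrtrM ?sqr_ge0// sqrtr_sqr.
Qed.

Variables (Gamma0 : set E) (T : R) (Phi : E * R -> E) (v nu : E * R -> E).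
Hypothesis hsurf : evolving_surface Gamma0 T Phi v.

Lemma penalty_test_material al c c2 a b z : spacetime Gamma0 T Phi z ->
  material_derivative Gamma0 T Phi (penalty_test al c c2 a b) z
    (al + 2 * c * dot (z.1 - a) (v z) + 2 * c2 * (z.2 - b)).
Proof.
case: z => x t [/= t0T [X GX <-]]; exists X; split => //=.
have dP := es_flow hsurf GX t0T.
have dp := is_derive_itvB dP (is_derive_itv_cst T a t).
have dt := @is_derive_itv_id R T t.
have dtb := is_derive_itvB dt (is_derive_itv_cst T (b : R^o) t).
have := is_derive_itvD (is_derive_itvD (is_derive_itvZ (a := al) dt)
  (is_derive_itvZ (a := c) (is_derive_itv_dot dp)))
  (is_derive_itvZ (a := c2) (is_derive_itv_sqr dtb)).
rewrite /penalty_test/= !subr0; congr (is_derive_itv _ _ _ _).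
rewrite /GRing.scale/=; ring.
Qed.

End TestFunction.

(** * Maxima of semicontinuous functions on compact sets *)

Section SemicontinuousMax.
Context {R : realType}.

(** A covering argument is used twice: first for an upper bound [d^-1], then, if the supremum [M]
    were not attained, for a uniform gap [d] below it. *)
Lemma usc_compact_max (X : topologicalType) (K : set X) (g : X -> R) :
  compact K -> K !=set0 ->
  (forall x a, K x -> g x < a -> \forall y \near within K (nbhs x), g y < a) ->
  exists2 x, K x & forall y, K y -> g y <= g x.
Proof.
move=> /compact_near_coveringP cK [x0 Kx0] usc.
have cover (Q : R -> X -> Prop) :
    (forall x, K x -> \forall y \near x & d \near (0 : R)^'+, K y -> Q d y) ->
    exists2 d : R, 0 < d & forall y, K y -> Q d y.
  move=> H.
  have Kd : \forall d \near (0 : R)^'+, K `<=` (fun y => K y -> Q d y).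
    exact: cK.
  near (0 : R)^'+ => d; exists d => // y Ky.
  have : K `<=` (fun y => K y -> Q d y) by near: d.
  by move=> /(_ y Ky Ky).
have near_lt x a : K x -> g x < a -> \forall y \near x, K y -> g y < a.
  by move=> Kx gx; exact: usc.
have [d1 d10 d1P] : exists2 d : R, 0 < d & forall y, K y -> g y <= d^-1.
  apply: cover => x Kx; have n1 := near_lt x (g x + 1) Kx ltac:(by rewrite ltrDl).
  have nd : \forall d \near (0 : R)^'+, 0 < d < (`|g x| + 1)^-1.
    near=> d; apply/andP; split; first by [].
    by near: d; apply: nbhs_right_lt; rewrite invr_gt0 ltr_wpDl.
  exists ([set y | K y -> g y < g x + 1], [set d | 0 < d < (`|g x| + 1)^-1]).
    by split.
  move=> [y d] /= [gy /andP[d0 dg]] Ky; apply: ltW.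
  apply: (lt_trans (gy Ky)); rewrite (@le_lt_trans _ _ (`|g x| + 1))//.
    by rewrite lerD2r ler_norm.
  by rewrite -[ltLHS]invrK ltf_pV2 ?posrE ?invr_gt0 ?ltr_wpDl.
have hs : has_sup (g @` K).
  split; first by exists (g x0), x0.
  by exists d1^-1 => _ [y Ky <-]; exact: d1P.
set M := sup (g @` K).
have gM y : K y -> g y <= M by move=> Ky; apply: (sup_upper_bound hs); exists y.
apply: contrapT => nmax.
have glt y : K y -> g y < M.
  move=> Ky; rewrite lt_neqAle gM// andbT; apply/eqP => gyM; apply: nmax.
  by exists y => // z Kz; rewrite gyM; exact: gM.
have [d d0 dP] : exists2 d : R, 0 < d & forall y, K y -> g y <= M - d.
  apply: cover => x Kx; have gx := glt x Kx.
  have n1 : \forall y \near x, K y -> g y < (g x + M) / 2.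
    by apply: near_lt => //; lra.
  exists ([set y | K y -> g y < (g x + M) / 2], [set d | d < (M - g x) / 2]).
    by split => //; apply: nbhs_right_lt; lra.
  by move=> [y d] /= [gy dg] Ky; have := gy Ky; lra.
have : M <= M - d.
  by apply: ge_sup; [exact: hs.1|move=> _ [y Ky <-]; exact: dP].
by rewrite leNgt ltrBlDr ltrDl d0.
Unshelve. all: by end_near. Qed.

Variables (Gamma0 : set 'rV[R]_3) (T : R) (Phi : 'rV[R]_3 * R -> 'rV[R]_3).
Notation S := (spacetime Gamma0 T Phi).

Lemma LSC_near (u : 'rV[R]_3 * R -> R) z a : LSC Gamma0 T Phi u -> S z ->
  a < u z -> \forall w \near z, S w -> a < u w.
Proof.
move=> lsc Sz az; have az' : (a%:E < (u z)%:E)%E by rewrite lte_fin.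
have [V Vz VP] := lsc z a az'.
have Vz' : \forall w \near z, S w -> V w.
  by move: Vz; rewrite /nbhs/= -nbhs_subspace_in.
near=> w => Sw; rewrite -lte_fin; apply: VP.
by move: Sw; near: w.
Unshelve. all: by end_near. Qed.

Lemma USC_near (u : 'rV[R]_3 * R -> R) z a : USC Gamma0 T Phi u -> S z ->
  u z < a -> \forall w \near z, S w -> u w < a.
Proof.
move=> usc Sz az.
have H : \forall w \near z, S w -> - a < - u w.
  by apply: (LSC_near (u := fun w => - u w)) => //; rewrite ltrN2.
by near=> w => Sw; rewrite -ltrN2; move: Sw; near: w.
Unshelve. all: by end_near. Qed.

(** If every decrement were at least [e], the sequence would eventually fall below [m]. *)
Lemma telescoping_small (M : nat -> R) m e : 0 < e -> (forall n, m <= M n) ->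
  exists n, M n - M n.+1 < e.
Proof.
move=> e0 Mm; apply: contrapT => /forallNP H.
have Hle n : M n <= M 0%N - n%:R * e.
  elim: n => [|n IH]; first by rewrite mul0r subr0.
  have /negP := H n; rewrite -leNgt -natr1 mulrDl mul1r; lra.
have [n nP] : exists n : nat, (M 0%N - m) / e < n%:R.
  exists (Num.bound `|(M 0%N - m) / e|).
  by rewrite (le_lt_trans (ler_norm _))// archi_boundP.
have := Hle n; have := Mm n; move: nP; rewrite ltr_pdivrMr//; lra.
Qed.

End SemicontinuousMax.

(** * The comparison principle *)

Section Comparison.
Context {R : realType}.
Notation E := 'rV[R]_3.
Variables (Gamma0 : set E) (T : R) (Phi : E * R -> E) (v nu : E * R -> E).
Hypothesis hsurf : evolving_surface Gamma0 T Phi v.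
Notation S := (spacetime Gamma0 T Phi).

Let pen (k : R) (z w : E * R) : R :=
  k * dot (z.1 - w.1) (z.1 - w.1) + k ^+ 2 * (z.2 - w.2) ^+ 2.

Let pen_continuous k (z w : E * R) :
  pen k p.1 p.2 @[p --> (z, w)] --> pen k z w.
Proof.
have c1 : (p.1.1 - p.2.1) @[p --> (z, w)] --> z.1 - w.1.
  apply: cvgB.
    exact: (cvg_comp _ _ (cvg_fst : fst @ (z, w) --> z) (cvg_fst : fst @ z --> z.1)).
  exact: (cvg_comp _ _ (cvg_snd : snd @ (z, w) --> w) (cvg_fst : fst @ w --> w.1)).
have c2 : (p.1.2 - p.2.2) @[p --> (z, w)] --> z.2 - w.2.
  apply: cvgB.
    exact: (cvg_comp _ _ (cvg_fst : fst @ (z, w) --> z) (cvg_snd : snd @ z --> z.2)).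
  exact: (cvg_comp _ _ (cvg_snd : snd @ (z, w) --> w) (cvg_snd : snd @ w --> w.2)).
apply: cvgD; apply: cvgM; try exact: cvg_cst.
  exact: (cvg_dot c1 c1).
by rewrite /= ; under eq_fun do rewrite expr2; rewrite expr2; exact: (cvgM c2 c2).
Qed.

Let pen_ge0 k z w : 0 <= k -> 0 <= pen k z w.
Proof. by move=> k0; apply: addr_ge0; apply: mulr_ge0; rewrite ?dot_ge0 ?sqr_ge0. Qed.

(* Doubling k at least doubles the penalty, so along k = 2^n the maxima
   decrease by at least half the penalty at the maximum point. *)
Let pen_double k z w : 0 <= k -> 2 * pen k z w <= pen (2 * k) z w.
Proof.
move=> k0; rewrite /pen mulrDr !mulrA lerD2l exprMn.
have : 0 <= k ^+ 2 * (z.2 - w.2) ^+ 2 by rewrite mulr_ge0 ?sqr_ge0.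
lra.
Qed.

(** The maxima for [k = 2^n] are at least [eta], because the penalty vanishes at the diagonal pair
    [(z0, z0)]; hence some decrement is small, and with it the penalty. *)
Lemma doubling_max (u1 u2 : E * R -> R) lam eta z0 e :
  USC Gamma0 T Phi u1 -> LSC Gamma0 T Phi u2 -> S z0 ->
  eta <= u1 z0 - u2 z0 - lam * z0.2 -> 0 < e ->
  exists k z w, [/\ 1 <= k, S z, S w & [/\ pen k z w < e,
    eta <= u1 z - u2 w - lam * z.2 - pen k z w &
    forall z' w', S z' -> S w' ->
      u1 z' - u2 w' - lam * z'.2 - pen k z' w' <=
      u1 z - u2 w - lam * z.2 - pen k z w]].
Proof.
move=> usc lsc Sz0 hz0 e0.
pose psi k (p : (E * R) * (E * R)) : R :=
  u1 p.1 - u2 p.2 - lam * p.1.2 - pen k p.1 p.2.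
have cS := spacetime_compact hsurf.
have psi_usc (k : R) (z w : E * R) (a : R) : S z -> S w -> psi k (z, w) < a ->
    \forall p \near (z, w), (S `*` S) p -> psi k p < a.
  move=> Sz Sw ha.
  have [e' e'0 he] : exists2 e' : R, 0 < e' & psi k (z, w) + 3 * e' < a.
    by exists ((a - psi k (z, w)) / 4); lra.
  have h1 := USC_near (a := u1 z + e') usc Sz ltac:(by rewrite ltrDl).
  have h2 := LSC_near (a := u2 w - e') lsc Sw ltac:(by rewrite ltrBlDr ltrDl).
  have c4 : p.1.2 @[p --> (z, w)] --> z.2.
    exact: (cvg_comp _ _ (cvg_fst : fst @ (z, w) --> z) (cvg_snd : snd @ z --> z.2)).
  have c5 : lam * p.1.2 @[p --> (z, w)] --> lam * z.2.
    exact: (cvgM (cvg_cst lam) c4).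
  have ct : (- (lam * p.1.2) - pen k p.1 p.2) @[p --> (z, w)] -->
      - (lam * z.2) - pen k z w.
    exact: (cvgB (cvgN c5) (@pen_continuous k z w)).
  have h3 : \forall p \near (z, w), - (lam * p.1.2) - pen k p.1 p.2 <
      - (lam * z.2) - pen k z w + e'.
    by move/cvgr_lt : ct; apply; rewrite ltrDl.
  have h1' : \forall p \near (z, w), S p.1 -> u1 p.1 < u1 z + e'.
    exact: ((cvg_fst : fst @ (z, w) --> z) _ h1).
  have h2' : \forall p \near (z, w), S p.2 -> u2 w - e' < u2 p.2.
    exact: ((cvg_snd : snd @ (z, w) --> w) _ h2).
  near=> p => -[Sp1 Sp2].
  have q1 : u1 p.1 < u1 z + e' by move: Sp1; near: p.
  have q2 : u2 w - e' < u2 p.2 by move: Sp2; near: p.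
  have q3 : - (lam * p.1.2) - pen k p.1 p.2 <
      - (lam * z.2) - pen k z w + e' by near: p.
  move: he; rewrite /psi/=; lra.
have /choice[P HP] : forall n : nat, exists p, (S p.1 /\ S p.2) /\
    forall q, S q.1 -> S q.2 -> psi (2 ^+ n) q <= psi (2 ^+ n) p.
  move=> n.
  have [||p Sp pmax] :=
    @usc_compact_max _ _ _ (psi (2 ^+ n)) (compact_setX cS cS).
  - by exists (z0, z0).
  - by move=> [z w] a [/= Sz Sw] ha; rewrite near_withinE; exact: psi_usc.
  - by exists p; split => // q Sq1 Sq2; exact: pmax.
pose M n := psi (2 ^+ n) (P n).
have eM n : eta <= M n.
  have := (HP n).2 (z0, z0) Sz0 Sz0; apply: le_trans.
  by rewrite /psi /pen/= !subrr /dot big1 ?mulr0 ?expr0n ?mulr0 ?addr0 ?subr0// =>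
    i _; rewrite mxE mul0r.
(* A decrement below [e / 2] makes the penalty of level [n.+1] at its own maximum point smaller than
   [e]. *)
have [n nP] := @telescoping_small _ M eta (e / 2) ltac:(by rewrite divr_gt0) eM.
have k0 : 0 <= 2 ^+ n :> R by rewrite exprn_ge0.
have [[S1 S2] mx] := HP n.+1.
exists (2 ^+ n.+1), (P n.+1).1, (P n.+1).2; split => //.
  by rewrite exprn_ege1// ler1n.
split.
- have := (HP n).2 (P n.+1) S1 S2; rewrite -/(M n).
  have := pen_double (P n.+1).1 (P n.+1).2 k0; rewrite -exprS.
  move: nP; rewrite /M /psi; lra.
- exact: eM.
- by move=> z' w' Sz' Sw'; exact: mx (z', w') Sz' Sw'.
Unshelve. all: by end_near. Qed.

(** At time 0 one has [u1 <= u0 <= u2]; semicontinuity spreads this, up to [eta], to nearby pairs,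
    and compactness makes the radius uniform. It keeps the maximum point off the initial time in
    both variables. *)
Lemma initial_gap (u1 u2 : E * R -> R) (u0 : E -> R) eta :
  USC Gamma0 T Phi u1 -> LSC Gamma0 T Phi u2 ->
  (forall x, surface Gamma0 Phi 0 x -> u1 (x, 0) <= u0 x) ->
  (forall x, surface Gamma0 Phi 0 x -> u0 x <= u2 (x, 0)) -> 0 < eta ->
  exists2 d : R, 0 < d & forall z w, S z -> S w -> `|w - z| < d ->
    z.2 <= 0 \/ w.2 <= 0 -> u1 z - u2 w < eta.
Proof.
move=> usc lsc i1 i2 eta0.
have /compact_near_coveringP cS := spacetime_compact hsurf.
pose P (d : R) z := S z -> forall w, S w -> `|w - z| < d ->
  z.2 <= 0 \/ w.2 <= 0 -> u1 z - u2 w < eta.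
have norm2 (w z : E * R) : `|w.2 - z.2| <= `|w - z|.
  by rewrite prod_normE le_max lexx orbT.
have local z0 : S z0 -> exists2 r : R, 0 < r &
    forall z w, S z -> S w -> `|z - z0| < r -> `|w - z0| < r ->
    z.2 <= 0 \/ w.2 <= 0 -> u1 z - u2 w < eta.
  move=> Sz0; have [z00|z0pos] := leP z0.2 0; last first.
    (* With this radius neither point can have nonpositive time, so the claim is vacuous. *)
    exists z0.2 => // z w Sz Sw zr wr [zn|wn].
      have := le_lt_trans (norm2 _ _) zr; rewrite ltr_norml => /andP[? ?]. lra.
    have := le_lt_trans (norm2 _ _) wr; rewrite ltr_norml => /andP[? ?]; lra.
  have z0E : z0 = (z0.1, 0).
    have [/andP[z0p _] _] := Sz0; rewrite [LHS]surjective_pairing; congr pair.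
    by apply/eqP; rewrite eq_le z00.
  have s0 : surface Gamma0 Phi 0 z0.1 by have [_] := Sz0; rewrite z0E.
  have u12 : u1 z0 <= u2 z0 by rewrite z0E (le_trans (i1 _ s0))// i2.
  have h1 := USC_near (a := u1 z0 + eta / 2) usc Sz0
    ltac:(by rewrite ltrDl divr_gt0).
  have h2 := LSC_near (a := u2 z0 - eta / 2) lsc Sz0
    ltac:(by rewrite ltrBlDr ltrDl divr_gt0).
  have h := near_norm_ball (filterI h1 h2).
  near (0 : R)^'+ => r; exists r => // z w Sz Sw zr wr _.
  have rP : forall x, `|x - z0| < r -> (S x -> u1 x < u1 z0 + eta / 2) /\
      (S x -> u2 z0 - eta / 2 < u2 x) by near: r; exact: h.
  have [/(_ Sz) q1 _] := rP _ zr; have [_ /(_ Sw) q2] := rP _ wr; lra.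
have cover z0 : S z0 -> \forall z \near z0 & d \near (0 : R)^'+, P d z.
  move=> /local[r r0 rP].
  have nx : \forall z \near z0, `|z - z0| < r / 2.
    apply/nbhs_normP; exists (r / 2) => /=; first exact: divr_gt0.
    by move=> x /=; rewrite distrC.
  exists ([set z | `|z - z0| < r / 2], [set d | d < r / 2]).
    by split => //; apply: nbhs_right_lt; rewrite divr_gt0.
  move=> [z d] /= [zr dr] Sz w Sw wz; apply: rP => //.
    by rewrite (lt_trans zr)// ltr_pdivrMr// ltr_pMr// ltr1n.
  rewrite [r]splitr -(subrK z w) -addrA (le_lt_trans (ler_normD _ _))//.
  by rewrite ltrD// (lt_trans wz).
have Pd : \forall d \near (0 : R)^'+, S `<=` P d by exact: cS.
near (0 : R)^'+ => d; exists d => // z w Sz.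
have dP : S `<=` P d by near: d.
exact: dP.
Unshelve. all: by end_near. Qed.

Hypothesis hnu : forall z, S z ->
  unit_outward_normal (surface Gamma0 Phi z.2) z.1 (nu z).

Lemma comparison (H : E * R -> E -> R) (L1 L2 : R) (u0 : E -> R)
    (u1 u2 : E * R -> R) :
  0 < L1 -> 0 < L2 -> hamiltonian_regular Gamma0 T Phi H L1 L2 ->
  viscosity_subsolution Gamma0 T Phi nu H u0 u1 ->
  viscosity_supersolution Gamma0 T Phi nu H u0 u2 ->
  forall z, S z -> u1 z <= u2 z.
Proof.
move=> L10 L20 [hH1 hH2] [_ usc i1 sub] [_ lsc i2 sup] z0 Sz0.
rewrite leNgt; apply/negP => u21.
have T0 := es_time hsurf.
(* The term [lam t] costs at most [eta] on the time interval, so half of the assumed gap survives at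
   [z0]. *)
pose eta := (u1 z0 - u2 z0) / 2; pose lam := eta / T.
have eta0 : 0 < eta by rewrite divr_gt0// subr_gt0.
have lam0 : 0 < lam by rewrite divr_gt0.
have hz0 : eta <= u1 z0 - u2 z0 - lam * z0.2.
  have : lam * z0.2 <= eta.
    rewrite /lam mulrAC ler_pdivrMr// ler_wpM2l ?(ltW eta0)//.
    by have [/andP[]] := Sz0.
  have : u1 z0 - u2 z0 = 2 * eta by rewrite /eta mulrC divfK.
  lra.
clearbody lam; clearbody eta.
have [d d0 hgap] := initial_gap usc lsc i1 i2 eta0.
have [Lv Lv0 hLv] := velocity_lipschitz hsurf.
have [C C0 hC] := normal_estimate hsurf hnu.
(* The summands account for the velocity difference, the two tangential projections, and the
   dependence of [H] on the space-time point. *)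
pose Ct := 12 * Lv + 8 * (L2 * C) + 15 * L1.
have Ct0 : 0 < Ct.
  by rewrite /Ct ltr_wpDl ?addr_ge0 ?mulr_ge0 ?(ltW L20)// mulr_gt0.
(* The bounds give, in turn, [mu^2 <= mu], applicability of [initial_gap], and the final
   contradiction [Ct mu < lam]. *)
pose mu := Num.min (Num.min 1 (d / 2)) (lam / (2 * Ct)).
have lamC : 0 < lam / (2 * Ct) by rewrite divr_gt0// mulr_gt0.
have mu0 : 0 < mu by rewrite !lt_min ltr01 lamC divr_gt0.
have mu1 : mu <= 1 by rewrite /mu !ge_min lexx.
have mud : mu < d.
  by rewrite (@le_lt_trans _ _ (d / 2)) ?ge_min ?lexx ?orbT//; lra.
have muC : Ct * mu < lam.
  apply: (@le_lt_trans _ _ (lam / 2)); last lra.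
  have : mu <= lam / (2 * Ct) by rewrite ge_min lexx orbT.
  rewrite ler_pdivlMr ?mulr_gt0// ler_pdivlMr//.
  by move=> h; rewrite (le_trans _ h)// le_eqVlt; apply/orP; left; apply/eqP; ring.
have [k [z [w [k1 Sz Sw [hpen hval hmax]]]]] :=
  doubling_max usc lsc Sz0 hz0 (exprn_gt0 2 mu0).
have k0 : 0 <= k by rewrite (le_trans ler01).
pose a := `|z.1 - w.1|; pose e := `|z.2 - w.2|.
have a0 : 0 <= a by exact: normr_ge0.
have e0 : 0 <= e by exact: normr_ge0.
have ka2 : k * a ^+ 2 <= mu ^+ 2.
  apply: le_trans (ltW hpen); rewrite /pen -[leLHS]addr0 lerD//.
    by rewrite ler_wpM2l// sqr_norm_le_dot.
  by rewrite mulr_ge0// sqr_ge0.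
have ke : k * e <= mu.
  rewrite -(@ler_pXn2r _ 2) ?nnegrE ?mulr_ge0 ?(ltW mu0)//.
  apply: le_trans (ltW hpen); rewrite /pen -[leLHS]add0r lerD//.
    by rewrite mulr_ge0// dot_ge0.
  by rewrite exprMn ler_wpM2l ?sqr_ge0// /e real_normK ?num_real.
have amu : a <= mu.
  rewrite -(@ler_pXn2r _ 2) ?nnegrE ?(ltW mu0)//.
  by apply: le_trans ka2; rewrite ler_peMl// sqr_ge0.
have emu : e <= mu by apply: le_trans ke; rewrite ler_peMl.
have zw : `|w - z| < d.
  apply: le_lt_trans mud; rewrite distrC prod_normE/= ge_max.
  by rewrite -/a -/e amu.
(* Otherwise [u1 z - u2 w] would be below [eta], against the lower bound on the maximum. *)
have zt : 0 < z.2 /\ 0 < w.2.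
  have nt : ~ (z.2 <= 0 \/ w.2 <= 0).
    move=> /(hgap z w Sz Sw zw); have : 0 <= lam * z.2.
      by rewrite mulr_ge0 ?(ltW lam0)//; have [/andP[]] := Sz.
    have := pen_ge0 z w k0; move: hval; lra.
  by split; rewrite ltNge; apply/negP => h; apply: nt; [left|right].
pose q := (2 * k) *: (z.1 - w.1).
have hsub : lam + 2 * k * dot (z.1 - w.1) (v z) + 2 * k ^+ 2 * (z.2 - w.2) +
    H z (q *m tangential_projection (nu z)) <= 0.
  pose phi := penalty_test lam k (k ^+ 2) w.1 w.2.
  apply: (sub phi (@penalty_test_C1_set _ _ _ _ _ _ _) z Sz zt.1).
  - rewrite /local_max near_withinE; apply: nearW => z' Sz'.
    have := hmax z' w Sz' Sw; rewrite /pen /phi /penalty_test; lra.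
  - exact: (penalty_test_material hsurf).
  - exists phi; split; first exact: penalty_test_extension.
    by rewrite penalty_test_grad.
(* With [z] frozen, [w] minimizes [u2] minus the negative penalty. The time term is the same as in
   [hsub] and cancels on subtraction. *)
have hsup : 0 <= 2 * k * dot (z.1 - w.1) (v w) + 2 * k ^+ 2 * (z.2 - w.2) +
    H w (q *m tangential_projection (nu w)).
  pose phi := penalty_test 0 (- k) (- k ^+ 2) z.1 z.2.
  apply: (sup phi (@penalty_test_C1_set _ _ _ _ _ _ _) w Sw zt.2).
  - rewrite /local_min near_withinE; apply: nearW => w' Sw'.
    have := hmax z w' Sz Sw'.
    rewrite /pen /phi /penalty_test -(opprB z.1 w.1) -(opprB z.1 w'.1).
    rewrite -(opprB z.2 w.2) -(opprB z.2 w'.2) !sqrrN !dotNl !dotNr; lra.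
  - have := penalty_test_material hsurf 0 (- k) (- k ^+ 2) z.1 z.2 Sw.
    rewrite -(opprB z.1 w.1) dotNl; congr material_derivative; ring.
  - exists phi; split; first exact: penalty_test_extension.
    by rewrite penalty_test_grad /q -(opprB z.1 w.1) mulrN scaleNr scalerN opprK.
have proj y : S y -> `|dot (nu y) (z.1 - w.1)| <= C * (a ^+ 2 + e) ->
    `|H y (q *m tangential_projection (nu y)) - H y q| <=
    2 * (L2 * C) * (k * a ^+ 2 + k * e).
  move=> Sy hy; rewrite (le_trans (hH2 _ _ _ Sy))// mul_tangential_projection.
  rewrite addrAC subrr add0r -scaleNr enormZ (nu_norm hnu Sy) mulr1 normrN.
  rewrite /q dotZl normrM ger0_norm ?mulr_ge0// dotC.
  have h : L2 * (2 * k) * `|dot (nu y) (z.1 - w.1)| <= L2 * (2 * k) * (C * (a ^+ 2 + e)).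
    by rewrite ler_wpM2l// !mulr_ge0// ltW.
  rewrite [leLHS]mulrA (le_trans h)// le_eqVlt; apply/orP; left; apply/eqP; ring.
have pz := proj z Sz (hC z w Sz Sw).
have pw : `|H w (q *m tangential_projection (nu w)) - H w q| <=
    2 * (L2 * C) * (k * a ^+ 2 + k * e).
  apply: proj => //; have := hC w z Sw Sz.
  by rewrite -(opprB z.1 w.1) dotNr !normrN [`|w.2 - _|]distrC.
have hzw : `|H w q - H z q| <= L1 * (2 * a + e) * (1 + 4 * (k * a)).
  apply: (le_trans (hH1 _ _ _ Sw Sz)); rewrite -mulrA -mulrA ler_wpM2l ?(ltW L10)//.
  apply: ler_pM; rewrite ?addr_ge0 ?sqrtr_ge0//.
    have n1 : enorm (w.1 - z.1) <= 2 * a by rewrite /a distrC enorm_le.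
    have n2 : `|w.2 - z.2| <= e by rewrite /e distrC.
    exact: (lerD n1 n2).
  rewrite lerD2l /q enormZ ger0_norm ?mulr_ge0//.
  have -> : 4 * (k * a) = 2 * k * (2 * a) by ring.
  by rewrite ler_wpM2l ?mulr_ge0// enorm_le.
have hv : `|dot (z.1 - w.1) (v w - v z)| <= 3 * a * (Lv * (a + e)).
  apply: (le_trans (norm_dot_le _ _)); rewrite -/a ler_wpM2l ?mulr_ge0//.
  apply: (le_trans (hLv _ _ Sz Sw)); rewrite ler_wpM2l//.
  rewrite distrC prod_normE/= ge_max -/a -/e lerDl lerDr.
  by rewrite e0 a0.
move: hsub hsup pz pw hzw hv; rewrite dotBr.
set D1 := dot _ (v z); set D2 := dot _ (v w).
set H1 := H z (q *m _); set H2 := H w (q *m _).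
move=> hsub hsup; rewrite !ler_norml.
move=> /andP[pz1 _] /andP[_ pw2] /andP[_ hzw2] /andP[_ hv2].
have mu2 : mu ^+ 2 <= mu by rewrite expr2 ler_piMl ?(ltW mu0).
have s1 : k * a ^+ 2 <= mu by apply: le_trans mu2.
(* Bounded as [(k e) a]; this is where the stronger weight [k^2] on the time difference enters for
   the mixed terms. *)
have s2 : k * a * e <= mu.
  rewrite mulrAC; apply: le_trans mu2; rewrite expr2.
  by rewrite ler_pM ?mulr_ge0.
have t1 : 2 * k * (D2 - D1) <= 12 * Lv * mu.
  apply: (@le_trans _ _ (2 * k * (3 * a * (Lv * (a + e))))).
    by rewrite ler_wpM2l ?mulr_ge0.
  have -> : 2 * k * (3 * a * (Lv * (a + e))) = 6 * Lv * (k * a ^+ 2 + k * a * e).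
    ring.
  have -> : 12 * Lv * mu = 6 * Lv * (mu + mu) by ring.
  by rewrite ler_wpM2l ?mulr_ge0// lerD.
have t2 : 2 * (L2 * C) * (k * a ^+ 2 + k * e) <= 4 * (L2 * C) * mu.
  have -> : 4 * (L2 * C) * mu = 2 * (L2 * C) * (mu + mu) by ring.
  by rewrite ler_wpM2l ?mulr_ge0 ?(ltW L20)// lerD.
have t3 : L1 * (2 * a + e) * (1 + 4 * (k * a)) <= 15 * L1 * mu.
  have -> : L1 * (2 * a + e) * (1 + 4 * (k * a)) =
    L1 * (2 * a + e + 8 * (k * a ^+ 2) + 4 * (k * a * e)) by ring.
  have -> : 15 * L1 * mu = L1 * (15 * mu) by ring.
  rewrite ler_wpM2l ?(ltW L10)//; lra.
have CtE : Ct * mu = 12 * Lv * mu + 8 * (L2 * C) * mu + 15 * L1 * mu.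
  by rewrite /Ct; ring.
have t4 : 2 * k * (D2 - D1) = 2 * k * D2 - 2 * k * D1 by rewrite mulrBr.
have t5 : 8 * (L2 * C) * mu = 2 * (4 * (L2 * C) * mu) by ring.
(* Subtracting [hsub] from [hsup] leaves [lam <= 2 k (D2 - D1) + H2 - H1 <= Ct mu], against
   [muC]. *)
lra.
Qed.

End Comparison.

Unset Implicit Arguments.

Theorem corollary3p1 (R : realType) (Gamma0 : set 'rV[R]_3) (T : R)
    (Phi : 'rV[R]_3 * R -> 'rV[R]_3) (v nu : 'rV[R]_3 * R -> 'rV[R]_3)
    (H : 'rV[R]_3 * R -> 'rV[R]_3 -> R) (L1 L2 : R)
    (hsurf : evolving_surface Gamma0 T Phi v)
    (hnu : forall z, spacetime Gamma0 T Phi z ->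
       unit_outward_normal (surface Gamma0 Phi z.2) z.1 (nu z))
    (hL1 : 0 < L1) (hL2 : 0 < L2)
    (hH : hamiltonian_regular Gamma0 T Phi H L1 L2)
    (u0 : 'rV[R]_3 -> R)
    (hu0 : {within surface Gamma0 Phi 0, continuous u0})
    (u1 u2 : 'rV[R]_3 * R -> R) :
  viscosity_solution Gamma0 T Phi nu H u0 u1 ->
  viscosity_solution Gamma0 T Phi nu H u0 u2 ->
  forall z, spacetime Gamma0 T Phi z -> u1 z = u2 z.
Proof.
(* Each solution is both a subsolution and a supersolution, so comparison applies in both orders. *)
move=> [sub1 sup1] [sub2 sup2] z Sz; apply: le_anti; apply/andP; split.
- exact: (comparison hsurf hnu hL1 hL2 hH sub1 sup2).
- exact: (comparison hsurf hnu hL1 hL2 hH sub2 sup1).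
Qed.
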